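(* Let $m,n\in\mathbb{Z}_{\ge 0}$, set $d_2=q^{-m}$, $d_3=q^{-n}$, and let $r_{i,j}(\Lambda)$ be defined by $\mathcal{H}_{\mathrm S}\,x^i=\sum_{j=-n}^{m} r_{i,j}(\Lambda)\,x^j$ for $-n\le i\le m$. Set $N=m+n$. Then the matrix $[r_{i,j}(\Lambda)]_{-n\le i,j\le m}$ coincides with the $(N+1)\times(N+1)$ block in the weight decomposition of the infinite-dimensional $R$-matrix for $U_{\mathsf v}(A_1^{(1)})$ (with ${\mathsf v}^2=q$) for evaluation representations of generic weights.
   Context: Notation: $(a)_k=(a;q)_k=\prod_{s=0}^{k-1}(1-aq^s)$, $\varphi(z)=(z;q)_\infty$, $|q|<1$. $\mathcal{B}$ is the $q$-Borel transformation, the linear operator on Laurent series in $x$ with $\mathcal{B}\,x^k=q^{k(k+1)/2}x^k$. For parameters $d_1,d_2,d_3,d_4$ the operator $\mathcal{H}_{\mathrm S}$ is $$\mathcal{H}_{\mathrm S}=\frac{1}{\varphi(qx)\varphi(\Lambda/x)}\cdot\mathcal{B}\cdot\frac{\varphi(\Lambda)\,\varphi(q^{-1}d_1d_2d_3d_4\Lambda)}{\varphi(-d_1x)\varphi(-d_2x)\varphi(-d_3\Lambda/x)\varphi(-d_4\Lambda/x)}\cdot\mathcal{B}\cdot\frac{1}{\varphi(q^{-1}d_1d_2x)\varphi(d_3d_4\Lambda/x)},$$ where functions of $x$ act by multiplication and are expanded as power series in $x$ and $\Lambda/x$. It is known beforehand that when $d_2=q^{-m}$, $d_3=q^{-n}$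 the operator $\mathcal{H}_{\mathrm S}$ preserves the span of $x^{-n},\dots,x^{m}$, so that the $r_{i,j}(\Lambda)$ are well defined; they are rational functions of the spectral parameter $\Lambda$, and depend also on the remaining parameters $d_1,d_4$. Meaning of ''coincides'': the $R$-matrix commutes with the total weight and so decomposes into finite blocks. One known explicit expression for the $(N+1)\times(N+1)$ block, with spectral parameter $z$ and generic weights encoded by $\alpha,\beta$, is, for $0\le i,j\le N$, $$R^{\rm HG}_{i,j}=\beta^{-j}\frac{(q)_N(\frac{\alpha}{z})_{N-i}(\frac1\beta)_{N-j}(\frac{\beta}{z})_j}{(q)_j(q)_{N-j}(\frac1z)_N(\frac1\beta)_{N-i}}\sum_{k=0}^{j}\frac{(q^{-j})_k(q^{i-N})_k(q^{1-N}z)_k(\frac{z}{\alpha\beta})_k}{(q)_k(q^{-N})_k(\frac{q^{1+i-N}z}{\alpha})_k(\frac{q^{1-j}z}{\beta})_k}\,q^k .$$ The coincidence is understood with the index shift $(i,j)\mapsto(i+n,j+n)$, the parameter dictionary $z=\Lambda/q$, $\alpha=q^{n}/d_1$, $\beta=q^{m}/d_4$, and relative to this form of the block it holds up to the row normalization factor $d_1^{\,m-i}q^{(m+1)i}$. *)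

(* Defs.v *)
From HB Require Import structures.
From mathcomp Require Import all_boot all_order all_algebra.
From mathcomp Require Import complex.
From mathcomp Require Import all_classical all_reals all_analysis.

Set Implicit Arguments.
Unset Strict Implicit.
Unset Printing Implicit Defensive.

Import Order.TTheory GRing.Theory Num.Theory.
Import numFieldNormedType.Exports.

Local Open Scope ring_scope.

(* (a; q)_k *)
Definition qpoch (F : fieldType) (q a : F) (k : nat) : F :=
  \prod_(s < k) (1 - a * q ^+ s).

(* The hypergeometric form of the (N+1) x (N+1) block of the R-matrix, with
   spectral parameter z and weights encoded by alpha, beta. *)
Definition RHG (F : fieldType) (q alpha beta z : F) (N i j : nat) : F :=
  let P := qpoch q in
  beta ^- j
  * (P q N * P (alpha / z) (N - i)%N * P beta^-1 (N - j)%N * P (beta / z) j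
     / (P q j * P q (N - j)%N * P z^-1 N * P beta^-1 (N - i)%N))
  * \sum_(k < j.+1)
      (P (q ^- j) k * P (q ^ (i%:Z - N%:Z)) k
         * P (q ^ (1 - N%:Z) * z) k * P (z / (alpha * beta)) k
       / (P q k * P (q ^- N) k
            * P (q ^ (1 + i%:Z - N%:Z) * z / alpha) k
            * P (q ^ (1 - j%:Z) * z / beta) k))
      * q ^+ k.

(* One-variable formal power series are represented by their coefficients. *)
Section PowerSeries.
Variable C : fieldType.

Fixpoint ps_inv_seq (f : nat -> C) (k : nat) : seq C :=
  if k is k'.+1 then
    let s := ps_inv_seq f k' in
    rcons s (- (f 0)^-1 * \sum_(l < k'.+1) f l.+1 * s`_(k' - l)%N)
  else [:: (f 0)^-1].

(* The reciprocal 1 / f, for f 0 != 0. *)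
Definition ps_inv (f : nat -> C) (k : nat) : C := (ps_inv_seq f k)`_k.

(* The Laurent series
     \sum_(a, b) lcoef a b * x^(lbase + a) * (Lambda / x)^b,
   an element of x^lbase C[[x, Lambda / x]].  Lambda is a formal variable;
   the monomials x^(lbase + a) * (Lambda / x)^b are pairwise distinct. *)
Record lseries := LSeries { lbase : int; lcoef : nat -> nat -> C }.

(* The coefficient of Lambda^b x^k. *)
Definition coefLx (u : lseries) (k : int) (b : nat) : C :=
  if (k - lbase u + b%:Z)%R is Posz a then lcoef u a b else 0.

Definition xpow (i : int) : lseries :=
  LSeries i (fun a b => ((a == 0%N) && (b == 0%N))%:R).

(* Multiplication by f(x), by f(Lambda / x) and by f(Lambda);
   note that Lambda = x * (Lambda / x). *)
Definition mul_x (f : nat -> C) (u : lseries) : lseries :=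
  LSeries (lbase u) (fun a b => \sum_(s < a.+1) f s * lcoef u (a - s)%N b).

Definition mul_Lx (f : nat -> C) (u : lseries) : lseries :=
  LSeries (lbase u) (fun a b => \sum_(s < b.+1) f s * lcoef u a (b - s)%N).

Definition mul_L (f : nat -> C) (u : lseries) : lseries :=
  LSeries (lbase u)
    (fun a b => \sum_(s < (minn a b).+1) f s * lcoef u (a - s)%N (b - s)%N).

(* The q-Borel transformation x^k |-> q^(k (k + 1) / 2) x^k. *)
Definition qBorel (q : C) (u : lseries) : lseries :=
  LSeries (lbase u) (fun a b =>
    let k : int := lbase u + a%:Z - b%:Z in
    q ^ ((k * (k + 1)) %/ 2)%Z * lcoef u a b).

(* The constants and the variable of C(Lambda) = {fraction {poly C}}. *)
Definition constL (c : C) : {fraction {poly C}} := tofrac (c%:P).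
Definition Lam : {fraction {poly C}} := tofrac 'X.

(* The power series s in Lambda is the expansion at Lambda = 0 of the
   rational function f. *)
Definition expansion_of (f : {fraction {poly C}}) (s : nat -> C) : Prop :=
  exists p d : {poly C},
    [/\ d != 0, f = tofrac p / tofrac d
      & forall b : nat, p`_b = \sum_(c < b.+1) d`_c * s (b - c)%N].

End PowerSeries.

Section Shakirov.
Variable R : realType.
Implicit Types q c d : R[i].

(* phi(c z) as a power series in z, where phi(z) = (z; q)_oo: the coefficients
   are the limits of those of the finite products. *)
Definition phi q c (k : nat) : R[i] :=
  limn (fun M : nat =>
    ((\prod_(s < M) (1 - (c * q ^+ s) *: 'X) : {poly R[i]})`_k : (R[i])^o)).

Definition phiV q c : nat -> R[i] := ps_inv (phi q c).

Definition HS q d1 d2 d3 d4 (u : lseries R[i]) : lseries R[i] :=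
  let pre := fun v => mul_x (phiV q q) (mul_Lx (phiV q 1) v) in
  let mid := fun v =>
    mul_L (phi q 1) (mul_L (phi q (q^-1 * d1 * d2 * d3 * d4))
     (mul_x (phiV q (- d1)) (mul_x (phiV q (- d2))
       (mul_Lx (phiV q (- d3)) (mul_Lx (phiV q (- d4)) v))))) in
  let post := fun v =>
    mul_x (phiV q (q^-1 * d1 * d2)) (mul_Lx (phiV q (d3 * d4)) v) in
  pre (qBorel q (mid (qBorel q (post u)))).

(* HS x^i = \sum_(-n <= j <= m) r i j * x^j for all -n <= i <= m, where
   d2 = q^(-m) and d3 = q^(-n), as an equality of Laurent series in x: every
   coefficient r i j is expanded in powers of Lambda. *)
Definition is_matrix_of_HS q d1 d4 (m n : nat)
    (r : int -> int -> {fraction {poly R[i]}}) : Prop :=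
  forall i : int, - n%:Z <= i <= m%:Z ->
  forall j : int,
    expansion_of (if - n%:Z <= j <= m%:Z then r i j else 0)
      (coefLx (HS q d1 (q ^- m) (q ^- n) d4 (xpow _ i)) j).

End Shakirov.

(* Main.v *)
(** Write y = Lambda / x, B for the q-Borel transformation, (q)_k for (q; q)_k
    and t(k) = k (k + 1) / 2.  The expansion
      phi(u v) / (phi(u) phi(v)) = \sum_(a, b) q^(a b) u^a v^b / ((q)_a (q)_b)
    turns into the closed form
      B (phi(c e Lambda) / (phi(c x) phi(e y)) x^i)
        = q^(t(i)) x^i phi(- c q^(i+1) x) phi(- e q^(-i) y).
    Used once on the right factor of H_S, and once (with c e = 1) to invert the
    left factor, it shows that H_S x^i = \sum_j r_(i,j) x^j is equivalent to the
    finite identity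
      \sum_j r_(i,j) q^(- t(j)) x^j (- q^(-m) x)_(m-j) (- q^(-n) y)_(n+j)
        = q^(t(i)) x^i (- d1 q^(i-m) x)_(m-i) (- d4 q^(-n-i) y)_(n+i),
    so that r is a connection matrix between two bases.  For the hypergeometric
    r_(i,j), both the sum over j (at fixed summation index k) and the remaining
    sum over k are q-Pfaff-Saalschuetz sums. *)
Require Import Defs.
From HB Require Import structures.
From mathcomp Require Import all_boot all_order all_algebra.
From mathcomp Require Import complex.
From mathcomp Require Import all_classical all_reals all_analysis.
From mathcomp Require Import ring zify.
Import Order.TTheory GRing.Theory Num.Theory.
Import numFieldNormedType.Exports.
Local Open Scope ring_scope.

Set Implicit Arguments.
Unset Strict Implicit.
Unset Printing Implicit Defensive.

(** * q-binomial coefficients and the q-Saalschuetz sum over a commutative ring *)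

Section QAlgebra.
Variables (A : comNzRingType) (q : A).

(** The block lives in C(Lambda), the expansions are compared through C[Lambda], and H_S x^i lives
    in C[[x, y]], where Lambda = x y, x and y have no inverses. Hence no identity that involves them
    may divide. Each (b / a)_k is replaced by its homogeneous form a^k (b / a)_k, which is
    [hpoch a b k], and r_(i,j) by a polynomial numerator over a denominator common to its row. The
    summation formulas are stated over any commutative ring, and the finite identity over any
    commutative ring receiving a morphism from the field of scalars; ring morphisms then carry the
    numerators from one ring to another. Denominators return only when the hypergeometric form is
    compared with its numerator in C(Lambda). The terminating 4phi3 in the block is not summable
    itself. Reversing its quotients of q-shifted factorials makes each term split into a factor free
    of j and a factor that depends on j and k only, and this is what allows the sum over j to be
    done first. *)

Definition hpoch (a b : A) (k : nat) : A := \prod_(s < k) (a - b * q ^+ s).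

Lemma hpoch0 a b : hpoch a b 0 = 1.
Proof. exact: big_ord0. Qed.

Lemma hpochS a b k : hpoch a b k.+1 = hpoch a b k * (a - b * q ^+ k).
Proof. exact: big_ord_recr. Qed.

Lemma hpochD a b k l : hpoch a b (k + l) = hpoch a b k * hpoch a (b * q ^+ k) l.
Proof.
rewrite /hpoch big_split_ord; congr (_ * _).
by apply: eq_bigr => s _; rewrite /= exprD mulrA.
Qed.

Lemma hpochSl a b k : hpoch a b k.+1 = (a - b) * hpoch a (b * q) k.
Proof. by rewrite -add1n hpochD hpochS hpoch0 mul1r expr0 mulr1 expr1. Qed.

Lemma hpochZ c a b k : hpoch (c * a) (c * b) k = c ^+ k * hpoch a b k.
Proof.
elim: k => [|k IHk]; first by rewrite !hpoch0 mul1r.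
by rewrite !hpochS IHk exprS; ring.
Qed.

(** The Gaussian binomial coefficient, given by its Pascal rule so that it exists without inverting
    (q)_k. Its vanishing for l > M later cuts off sums. *)
Fixpoint qbin (M l : nat) : A :=
  match M, l with
  | _, 0%N => 1
  | 0%N, _.+1 => 0
  | M'.+1, l'.+1 => qbin M' l + q ^+ (M' - l') * qbin M' l'
  end.
Arguments qbin : simpl never.

Lemma qbin0 M : qbin M 0 = 1. Proof. by case: M. Qed.

Lemma qbinS M l : qbin M.+1 l.+1 = qbin M l.+1 + q ^+ (M - l) * qbin M l.
Proof. by []. Qed.

Lemma qbin_small M l : (M < l)%N -> qbin M l = 0.
Proof.
elim: M l => [|M IHM] [|l] // ltMl.
by rewrite qbinS !IHM ?mulr0 ?addr0 // ltnW.
Qed.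

Lemma qbinn M : qbin M M = 1.
Proof. by elim: M => // M IHM; rewrite qbinS IHM qbin_small // subnn mulr1 add0r. Qed.

Lemma qbin_next M l :
  (1 - q ^+ l.+1) * qbin M l.+1 = (1 - q ^+ (M - l)) * qbin M l.
Proof.
elim: M l => [|M IHM] l; first by rewrite mulr0 sub0n expr0 subrr mul0r.
have [leMl | ltlM] := leqP M.+1 l.
  have -> : (M.+1 - l = 0)%N by lia.
  by rewrite expr0 subrr mul0r qbin_small ?mulr0.
rewrite qbinS mulrDr IHM.
have -> : (1 - q ^+ (M - l)) * qbin M l
     + (1 - q ^+ l.+1) * (q ^+ (M - l) * qbin M l) = (1 - q ^+ M.+1) * qbin M l.
  have eM : M.+1 = (M - l + l.+1)%N by lia.
  by rewrite [in RHS]eM exprD; ring.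
case: l ltlM => [|l] ltlM; first by rewrite !qbin0 subn0.
rewrite subSS qbinS mulrDr mulrCA -IHM.
have eM : M.+1 = (M - l + l.+1)%N by lia.
by rewrite [X in 1 - q ^+ X]eM exprD; ring.
Qed.

Lemma qbin_hpoch M l : (l <= M)%N ->
  qbin M l * (hpoch 1 q l * hpoch 1 q (M - l)) = hpoch 1 q M.
Proof.
elim: l => [|l IHl] ltlM; first by rewrite qbin0 hpoch0 !mul1r subn0.
rewrite -{}IHl ?(ltnW ltlM) // hpochS -exprS.
have -> : (M - l = (M - l.+1).+1)%N by lia.
rewrite hpochS -exprS (_ : (M - l.+1).+1 = (M - l)%N); last by lia.
transitivity ((1 - q ^+ l.+1) * qbin M l.+1 * (hpoch 1 q l * hpoch 1 q (M - l.+1))).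
  by ring.
by rewrite qbin_next; ring.
Qed.

(** Multiplying by w - q^a produces the two terms of the Pascal rule, because q^a = q^(a-s) q^s
    supplies both the weight in [qbinS] and the growth of the exponent 'C(s, 2). *)
Lemma gauss_binomial w a :
  \sum_(s < a.+1) qbin a s * (-1) ^+ s * q ^+ 'C(s, 2) * w ^+ (a - s)
  = hpoch w 1 a.
Proof.
elim: a => [|a IHa].
  by rewrite big_ord_recl big_ord0 hpoch0 /= bin0n !mulr1 addr0.
rewrite hpochS -{}IHa big_ord_recl /= qbin0 expr0 bin0n expr0 subn0.
under eq_bigr => s _.
  rewrite /bump leq0n add1n qbinS subSS !mulrDl.
  over.
rewrite big_split /= addrA mulrBr; congr (_ + _).
  rewrite big_ord_recr /= qbin_small // !mul0r addr0.
  rewrite big_ord_recl /= mulrDl; congr (_ + _).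
    by rewrite qbin0 bin0n subn0 exprSr !mulr1 !mul1r.
  rewrite mulr_suml; apply: eq_bigr => s _.
  have -> : (a - s = (a - s.+1).+1)%N by have := ltn_ord s; lia.
  by rewrite /bump leq0n add1n (exprSr w) !mulrA.
rewrite -mulrN mulr_suml; apply: eq_bigr => s _.
have -> : q ^+ a = q ^+ (a - s) * q ^+ s.
  by rewrite -exprD subnK // -ltnS ltn_ord.
by rewrite binS bin1 exprD exprS; ring.
Qed.

(* The q-Pfaff-Saalschuetz sum with all denominators cleared: the hypotheses say
   that c1 / c0, e1 / e0, r1 / r0, s1 / s0 are a b e, e, a e, b e for
   a = a1 / a0, b = b1 / b0 and e = e1 / e0. *)
Section Saalschuetz.
Variables a0 a1 b0 b1 f c0 c1 e0 e1 r0 r1 s0 s1 : A.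
Hypotheses (e1c0 : e1 * c0 = f * a0 * b0) (c1e0 : c1 * e0 = f * a1 * b1).
Hypotheses (r1s0 : r1 * s0 = f * a1 * b0) (r0s1 : r0 * s1 = f * a0 * b1).
Hypotheses (c0e0 : c0 * e0 = r0 * s0) (c1e1 : c1 * e1 = r1 * s1).

Let T M l := qbin M l * hpoch a0 a1 l * hpoch b0 b1 l * f ^+ l
  * hpoch c0 (c1 * q ^+ l) (M - l) * hpoch e0 e1 (M - l).

(** A telescoping certificate. With G l = q^(M-l) f (a0 - a1 q^l) (b0 - b1 q^l) T M l, the
    difference T M.+1 l - (r0 - r1 q^M) (s0 - s1 q^M) T M l equals G (l-1) - G l. At L = M the
    leftover - G M cancels the new top term T M.+1 M.+1. *)
Lemma saalschuetz_partial_sum M L : (L <= M)%N ->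
  \sum_(l < L.+1) T M.+1 l
  = (r0 - r1 * q ^+ M) * (s0 - s1 * q ^+ M) * (\sum_(l < L.+1) T M l)
    - q ^+ (M - L) * f * (a0 - a1 * q ^+ L) * (b0 - b1 * q ^+ L) * T M L.
Proof.
(* For M = l + r the left side is the factor gained by the last two products of [T] when M grows by
   one. The six hypotheses serve to match coefficients in q^l and q^r. *)
have step l r : (c0 - c1 * q ^+ (l + r)) * (e0 - e1 * q ^+ r)
    = (r0 - r1 * q ^+ (l + r)) * (s0 - s1 * q ^+ (l + r))
      - q ^+ r * f * (a0 - a1 * q ^+ l) * (b0 - b1 * q ^+ l)
      - (1 - q ^+ l) * q ^+ (l + r) * c1 * (e0 - e1 * q ^+ r).
  rewrite exprD; move: (q ^+ l) (q ^+ r) => u v.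
  transitivity (c0 * e0 - v * (e1 * c0) - u * v * (c1 * e0)
    + u * v ^+ 2 * (c1 * e1)); first by ring.
  rewrite e1c0.
  transitivity (r0 * s0 - u * v * (r1 * s0 + r0 * s1) + (u * v) ^+ 2 * (r1 * s1)
    - v * f * (a0 - a1 * u) * (b0 - b1 * u)
    - (1 - u) * u * v * (c1 * e0) + (1 - u) * u * v ^+ 2 * (c1 * e1)).
    by rewrite r1s0 r0s1 c1e0 c0e0 c1e1; ring.
  by ring.
elim: L => [|L IHL] leLM.
  rewrite !big_ord_recl !big_ord0 /T !hpoch0 !qbin0 !subn0 !hpochS !expr0 !mulr1.
  have := step 0%N M; rewrite add0n expr0 !mulr1 subrr !mul0r subr0 => stepM.
  rewrite !mul1r !addr0.
  transitivity (hpoch c0 c1 M * hpoch e0 e1 M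
    * ((c0 - c1 * q ^+ M) * (e0 - e1 * q ^+ M))); first by ring.
  by rewrite stepM; ring.
rewrite big_ord_recr {}IHL ?(ltnW leLM) //= [in RHS]big_ord_recr /=.
set Sm := \sum_(_ < _) _.
have [r defM] : exists r, M = (L.+1 + r)%N by exists (M - L.+1)%N; lia.
have eT : T M.+1 L.+1 = ((r0 - r1 * q ^+ M) * (s0 - s1 * q ^+ M)
    - q ^+ (M - L.+1) * f * (a0 - a1 * q ^+ L.+1) * (b0 - b1 * q ^+ L.+1))
      * T M L.+1
    + q ^+ (M - L) * f * (a0 - a1 * q ^+ L) * (b0 - b1 * q ^+ L) * T M L.
  have qn := qbin_next M L.
  have e1r : (M - L.+1 = r)%N by lia.
  have e2r : (M - L = r.+1)%N by lia.
  rewrite e2r in qn; rewrite /T qbinS subSS e1r e2r (hpochSl c0 (c1 * q ^+ L)).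
  rewrite -(mulrA c1) -exprSr !(hpochS _ _ r) !(hpochS _ _ L).
  rewrite -(mulrA c1) -exprD -defM.
  have := step L.+1 r; rewrite -defM.
  have : q ^+ M = q ^+ r.+1 * q ^+ L by rewrite -exprD; congr (_ ^+ _); lia.
  rewrite (exprS f).
  move: (qbin M L.+1) (qbin M L) qn => bS bL qn.
  move: (hpoch a0 a1 L) (hpoch b0 b1 L) => ha hb.
  move: (hpoch c0 (c1 * q ^+ L.+1) r) (hpoch e0 e1 r) => hc he.
  move: (q ^+ L.+1) (q ^+ L) (q ^+ r.+1) (q ^+ r) (q ^+ M) (f ^+ L) qn.
  move=> qLS qL qrS qr uv fL qn euv.
  move=> stepL; set K := ha * (a0 - a1 * qL) * (hb * (b0 - b1 * qL)) * (f * fL) * hc * he.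
  transitivity (K * (bS * ((c0 - c1 * uv) * (e0 - e1 * qr))
     + qrS * bL * (c0 - c1 * uv) * (e0 - e1 * qr))).
    by rewrite /K; ring.
  rewrite stepL.
  transitivity (K * (bS * ((r0 - r1 * uv) * (s0 - s1 * uv)
        - qr * f * (a0 - a1 * qLS) * (b0 - b1 * qLS))
     + (qrS * bL * (c0 - c1 * uv) - (1 - qLS) * bS * uv * c1)
       * (e0 - e1 * qr))); first by ring.
  rewrite qn euv /K; ring.
move: (T _ _) (T _ _) (T _ _) eT => t1 t2 t3 ->.
by ring.
Qed.

Lemma saalschuetz M :
  \sum_(l < M.+1) qbin M l * hpoch a0 a1 l * hpoch b0 b1 l * f ^+ l
    * hpoch c0 (c1 * q ^+ l) (M - l) * hpoch e0 e1 (M - l)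
  = hpoch r0 r1 M * hpoch s0 s1 M.
Proof.
elim: M => [|M IHM].
  by rewrite big_ord_recl big_ord0 /= !hpoch0 expr0 !mulr1 addr0.
rewrite big_ord_recr /= -/(T _ _) saalschuetz_partial_sum // /T IHM.
rewrite !subnn !hpoch0 !qbinn !expr0 !(hpochS a0) !(hpochS b0) !(hpochS r0).
by rewrite !(hpochS s0) exprS; ring.
Qed.

End Saalschuetz.

End QAlgebra.

Arguments qbin : simpl never.

Section QMorphism.
Variables (A B : comNzRingType) (g : {rmorphism A -> B}) (q : A).

Lemma rmorph_hpoch a b k : g (hpoch q a b k) = hpoch (g q) (g a) (g b) k.
Proof.
rewrite rmorph_prod; apply: eq_bigr => s _.
by rewrite rmorphB rmorphM rmorphXn.
Qed.

Lemma rmorph_qbin M l : g (qbin q M l) = qbin (g q) M l.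
Proof.
elim: M l => [|M IHM] [|l]; rewrite ?rmorph0 ?rmorph1 //.
by rewrite !qbinS rmorphD rmorphM rmorphXn !IHM.
Qed.

End QMorphism.

(** * Formal power series in one and two variables *)

Record ps (R : Type) := PS { psc : nat -> R }.

HB.instance Definition _ (R : Type) := gen_eqMixin (ps R).
HB.instance Definition _ (R : Type) := gen_choiceMixin (ps R).

Lemma ps_ext (R : Type) (f g : ps R) : psc f =1 psc g -> f = g.
Proof. by case: f g => [f] [g] /= /funext ->. Qed.

Section PowerSeriesRing.
Variable R : comNzRingType.
Implicit Types (f g h : ps R) (p : {poly R}).

Definition ps_zero : ps R := PS (fun=> 0).
Definition ps_opp f : ps R := PS (fun k => - psc f k).
Definition ps_add f g : ps R := PS (fun k => psc f k + psc g k).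

Fact ps_addA : associative ps_add.
Proof. by move=> f g h; apply: ps_ext => k /=; rewrite addrA. Qed.
Fact ps_addC : commutative ps_add.
Proof. by move=> f g; apply: ps_ext => k /=; rewrite addrC. Qed.
Fact ps_add0 : left_id ps_zero ps_add.
Proof. by move=> f; apply: ps_ext => k /=; rewrite add0r. Qed.
Fact ps_addN : left_inverse ps_zero ps_opp ps_add.
Proof. by move=> f; apply: ps_ext => k /=; rewrite addNr. Qed.

HB.instance Definition _ :=
  GRing.isZmodule.Build (ps R) ps_addA ps_addC ps_add0 ps_addN.

Definition ps_one : ps R := PS (fun k => (k == 0%N)%:R).
Definition ps_mul f g : ps R :=
  PS (fun k => \sum_(i < k.+1) psc f i * psc g (k - i)%N).

Let trunc n f := \poly_(i < n) psc f i.

Let coef_trunc n f k : (k < n)%N -> (trunc n f)`_k = psc f k.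
Proof. by move=> ltkn; rewrite coef_poly ltkn. Qed.

(** Coefficient k of a product sees only finitely many coefficients of its factors, so the ring
    axioms are inherited from polynomials. *)
Let ps_mul_trunc n f g k : (k < n)%N ->
  psc (ps_mul f g) k = (trunc n f * trunc n g)`_k.
Proof.
move=> ltkn; rewrite coefM; apply: eq_bigr => i _.
by rewrite !coef_trunc //; have := ltn_ord i; lia.
Qed.

Fact ps_mulC : commutative ps_mul.
Proof.
by move=> f g; apply: ps_ext => k; rewrite !(@ps_mul_trunc k.+1) // mulrC.
Qed.

Fact ps_mulA : associative ps_mul.
Proof.
move=> f g h; apply: ps_ext => k.
transitivity ((trunc k.+1 f * (trunc k.+1 g * trunc k.+1 h))`_k).
  rewrite coefM; apply: eq_bigr => i _; have := ltn_ord i => ltik.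
  by rewrite (@ps_mul_trunc k.+1) ?coef_trunc //; lia.
rewrite mulrA coefM; apply: eq_bigr => i _; have := ltn_ord i => ltik.
by rewrite (@ps_mul_trunc k.+1) ?coef_trunc //; lia.
Qed.

Fact ps_mul1 : left_id ps_one ps_mul.
Proof.
move=> f; apply: ps_ext => k /=; rewrite big_ord_recl /= mul1r subn0.
by rewrite big1 ?addr0 // => i _; rewrite mul0r.
Qed.

Fact ps_mulDl : left_distributive ps_mul ps_add.
Proof.
move=> f g h; apply: ps_ext => k /=; rewrite -big_split /=.
by apply: eq_bigr => i _; rewrite mulrDl.
Qed.

Fact ps_one_neq0 : ps_one != ps_zero.
Proof.
by apply/eqP => /(congr1 (fun f => psc f 0)) /= /eqP; rewrite oner_eq0.
Qed.

HB.instance Definition _ := GRing.Zmodule_isComNzRing.Build (ps R)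
  ps_mulA ps_mulC ps_mul1 ps_mulDl ps_one_neq0.

Lemma pscD f g k : psc (f + g) k = psc f k + psc g k. Proof. by []. Qed.
Lemma psc1 k : psc (1 : ps R) k = (k == 0%N)%:R. Proof. by []. Qed.
Lemma pscM f g k : psc (f * g) k = \sum_(i < k.+1) psc f i * psc g (k - i)%N.
Proof. by []. Qed.

Lemma psc_sum (I : Type) (r : seq I) (P : pred I) (F : I -> ps R) k :
  psc (\sum_(i <- r | P i) F i) k = \sum_(i <- r | P i) psc (F i) k.
Proof. exact: (big_morph (fun f => psc f k) (fun f g => pscD f g k)). Qed.

Definition ps_poly p : ps R := PS (fun k => p`_k).

Fact ps_poly_zmod : zmod_morphism ps_poly.
Proof. by move=> p1 p2; apply: ps_ext => k /=; rewrite coefB. Qed.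
Fact ps_poly_monoid : monoid_morphism ps_poly.
Proof.
split; first by apply: ps_ext => k /=; rewrite coef1.
by move=> p1 p2; apply: ps_ext => k /=; rewrite coefM.
Qed.

HB.instance Definition _ :=
  GRing.isZmodMorphism.Build {poly R} (ps R) ps_poly ps_poly_zmod.
HB.instance Definition _ :=
  GRing.isMonoidMorphism.Build {poly R} (ps R) ps_poly ps_poly_monoid.

Lemma ps_poly_inj : injective ps_poly.
Proof. by move=> p1 p2 [] /funeqP eqp; apply/polyP. Qed.

Definition psC : R -> ps R := ps_poly \o polyC.
HB.instance Definition _ := GRing.RMorphism.on psC.
Definition psX : ps R := ps_poly 'X.

Lemma psc_C c k : psc (psC c) k = if k is 0%N then c else 0.
Proof. by rewrite /= coefC; case: k. Qed.

Lemma pscCM c f k : psc (psC c * f) k = c * psc f k.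
Proof.
rewrite pscM big_ord_recl psc_C subn0 big1 ?addr0 // => i _.
by rewrite psc_C mul0r.
Qed.

Lemma pscXnM n f k : psc (psX ^+ n * f) k = if (n <= k)%N then psc f (k - n)%N else 0.
Proof.
rewrite -rmorphXn pscM; case: leqP => [lenk | ltkn].
  rewrite (bigD1 (inord n)) //= inordK ?ltnS // coefXn eqxx mul1r.
  rewrite big1 ?addr0 // => i; rewrite -val_eqE /= inordK ?ltnS // coefXn.
  by move=> /negPf->; rewrite mul0r.
rewrite big1 // => i _; rewrite /= coefXn.
by rewrite (_ : (i == n :> nat) = false) ?mul0r //; have := ltn_ord i; lia.
Qed.

End PowerSeriesRing.

Section PowerSeriesMap.
Variables (R S : comNzRingType) (g : {rmorphism R -> S}).

Definition ps_map (f : ps R) : ps S := PS (fun k => g (psc f k)).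

Fact ps_map_zmod : zmod_morphism ps_map.
Proof. by move=> f h; apply: ps_ext => k /=; rewrite rmorphB. Qed.
Fact ps_map_monoid : monoid_morphism ps_map.
Proof.
split; first by apply: ps_ext => k /=; rewrite rmorph_nat.
move=> f h; apply: ps_ext => k /=; rewrite rmorph_sum.
by apply: eq_bigr => i _; rewrite rmorphM.
Qed.

HB.instance Definition _ :=
  GRing.isZmodMorphism.Build (ps R) (ps S) ps_map ps_map_zmod.
HB.instance Definition _ :=
  GRing.isMonoidMorphism.Build (ps R) (ps S) ps_map ps_map_monoid.

End PowerSeriesMap.

(* C[[x, y]] is encoded as C[[y]][[x]]: the outer index is the exponent of x,
   the inner one that of y = Lambda / x. *)
Section TwoVariables.
Variable C : comNzRingType.
Notation S := (ps (ps C)).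
Implicit Types (f : ps C) (F : S).

Definition psc2 F a b : C := psc (psc F a) b.

Lemma psc2_ext F G : psc2 F =2 psc2 G -> F = G.
Proof. by move=> eqFG; apply: ps_ext => a; apply: ps_ext => b; apply: eqFG. Qed.

Lemma psc2D F G a b : psc2 (F + G) a b = psc2 F a b + psc2 G a b.
Proof. by []. Qed.

Definition inx : ps C -> S := ps_map (@psC C).
HB.instance Definition _ := GRing.RMorphism.on inx.
Definition iny : ps C -> S := @psC (ps C).
HB.instance Definition _ := GRing.RMorphism.on iny.
(** The series f(x y), which is f(Lambda). *)
Definition inL f : S := PS (fun a => psC (psc f a) * psX C ^+ a).

Lemma psc_inL f a : psc (inL f) a = psC (psc f a) * psX C ^+ a.
Proof. by []. Qed.

Fact inL_zmod : zmod_morphism inL.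
Proof. by move=> f h; apply: ps_ext => k /=; rewrite rmorphB mulrBl. Qed.
Fact inL_monoid : monoid_morphism inL.
Proof.
split.
  apply: ps_ext => -[|k] /=; rewrite ?rmorph0 ?mul0r //.
  by rewrite rmorph1 mul1r expr0.
move=> f h; apply: ps_ext => k /=; rewrite rmorph_sum mulr_suml.
apply: eq_bigr => i _; rewrite rmorphM mulrACA -exprD subnKC //.
by rewrite -ltnS ltn_ord.
Qed.
HB.instance Definition _ := GRing.isZmodMorphism.Build (ps C) S inL inL_zmod.
HB.instance Definition _ := GRing.isMonoidMorphism.Build (ps C) S inL inL_monoid.

Definition cstxy : C -> S := @psC (ps C) \o @psC C.
HB.instance Definition _ := GRing.RMorphism.on cstxy.

Definition varx : S := psX (ps C).
Definition vary : S := iny (psX C).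

Lemma inx_C c : inx (psC c) = cstxy c.
Proof. by apply: ps_ext => k /=; rewrite !coefC; case: eqP; rewrite ?rmorph0. Qed.
Lemma inx_X : inx (psX C) = varx.
Proof. by apply: ps_ext => k /=; rewrite !coefX; case: eqP; rewrite ?rmorph1 ?rmorph0. Qed.
Lemma inL_C c : inL (psC c) = cstxy c.
Proof.
apply: ps_ext => k; rewrite psc_C /= coefC; case: k => [|k] /=.
  by rewrite expr0 mulr1.
by rewrite rmorph0 mul0r.
Qed.
Lemma inL_X : inL (psX C) = varx * vary.
Proof.
rewrite mulrC; apply: ps_ext => k; rewrite pscCM /= !coefX.
case: k => [|[|k]] /=; rewrite ?rmorph0 ?mulr0 ?mul0r //.
by rewrite rmorph1 mul1r mulr1 expr1.
Qed.

Lemma psc2_inxM f F a b :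
  psc2 (inx f * F) a b = \sum_(s < a.+1) psc f s * psc2 F (a - s) b.
Proof.
by rewrite /psc2 pscM psc_sum; apply: eq_bigr => s _; rewrite pscCM.
Qed.

Lemma psc2_inyM f F a b :
  psc2 (iny f * F) a b = \sum_(s < b.+1) psc f s * psc2 F a (b - s).
Proof. by rewrite /psc2 pscCM pscM. Qed.

Lemma psc2_inLM f F a b : psc2 (inL f * F) a b =
  \sum_(s < (minn a b).+1) psc f s * psc2 F (a - s) (b - s).
Proof.
rewrite /psc2 pscM psc_sum.
rewrite (big_ord_widen a.+1
  (fun s => psc f s * psc2 F (a - s) (b - s))) ?ltnS ?geq_minl //.
rewrite [RHS]big_mkcond; apply: eq_bigr => s _.
rewrite -mulrA pscCM pscXnM ltnS leq_min -(ltnS s a) ltn_ord /=.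
by case: ifP; rewrite ?mulr0.
Qed.

Lemma psc2_cstxyM c F a b : psc2 (cstxy c * F) a b = c * psc2 F a b.
Proof. by rewrite /psc2 !pscCM. Qed.

Lemma psc2_monoM s t F a b : psc2 (varx ^+ s * vary ^+ t * F) a b =
  if (s <= a)%N && (t <= b)%N then psc2 F (a - s) (b - t) else 0.
Proof.
rewrite -mulrA /psc2 pscXnM; case: leqP => _; last by [].
rewrite andTb.
have -> : vary ^+ t = iny (psX C ^+ t) by rewrite rmorphXn.
by rewrite pscCM pscXnM.
Qed.

End TwoVariables.

(** * Triangular exponents and the q-Borel transformation *)

Definition tri (k : int) : int := ((k * (k + 1)) %/ 2)%Z.

Lemma tri2 k : tri k * 2 = k * (k + 1).
Proof.
apply: divzK; have [j [->|->]] : exists j : int, k = j * 2 \/ k = j * 2 + 1.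
- by exists (k %/ 2)%Z; lia.
- by rewrite -mulrA mulrCA dvdz_mulr.
have -> : j * 2 + 1 + 1 = 2 * (j + 1) by ring.
by rewrite mulrCA dvdz_mulr.
Qed.

(** Together with [tri2], this lets exponents of q be compared after doubling, where they are
    polynomials in the indices. *)
Lemma bin2_double k : ('C(k, 2)%:Z * 2 = k%:Z * (k%:Z - 1))%R.
Proof.
elim: k => [|k IHk]; first by rewrite bin0n mul0r.
by rewrite binS bin1; lia.
Qed.

Section Borel.
Variables (C : fieldType) (q : C).
Notation S := (ps (ps C)).

(* The operator x^(-i) B x^i. *)
Definition borel (i : int) (F : S) : S :=
  PS (fun a => PS (fun b => q ^ tri (i + a%:Z - b%:Z) * psc2 F a b)).

Lemma psc2_borel i F a b :
  psc2 (borel i F) a b = q ^ tri (i + a%:Z - b%:Z) * psc2 F a b.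
Proof. by []. Qed.

Lemma borel0 i : borel i 0 = 0.
Proof. by apply: psc2_ext => a b; rewrite psc2_borel mulr0. Qed.

Lemma borelD i F G : borel i (F + G) = borel i F + borel i G.
Proof.
by apply: psc2_ext => a b; rewrite psc2D !psc2_borel psc2D mulrDr.
Qed.

Lemma borel_sum i n (F : 'I_n -> S) :
  borel i (\sum_(s < n) F s) = \sum_(s < n) borel i (F s).
Proof. exact: (big_morph _ (borelD i) (borel0 i)). Qed.

(** The weight of x^a y^b depends on a - b only, and multiplication by a power of x y preserves a -
    b. *)
Lemma borel_inLM i f F : borel i (inL f * F) = inL f * borel i F.
Proof.
apply: psc2_ext => a b; rewrite psc2_borel !psc2_inLM mulr_sumr.
apply: eq_bigr => s _; rewrite psc2_borel mulrCA.
congr (_ * (_ ^ tri _ * _)); have := ltn_ord s.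
by rewrite ltnS leq_min => /andP[lea leb]; lia.
Qed.

Lemma borel_cstxyM i c F : borel i (cstxy c * F) = cstxy c * borel i F.
Proof. by rewrite -inL_C borel_inLM. Qed.

Lemma borel_monoM i s t F : borel i (varx C ^+ s * vary C ^+ t * F)
  = varx C ^+ s * vary C ^+ t * borel (i + s%:Z - t%:Z) F.
Proof.
apply: psc2_ext => a b; rewrite psc2_borel !psc2_monoM.
case: ifP => [/andP[lesa letb] | _]; last by rewrite mulr0.
by rewrite psc2_borel; congr (_ ^ tri _ * _); lia.
Qed.

End Borel.

(** * q-exponential series and their q-Borel transforms *)

Section QExponential.
Variables (C : fieldType) (q : C).
Hypotheses (q0 : q != 0) (qfact_neq0 : forall k, hpoch q 1 q k != 0).
Notation qfact k := (hpoch q 1 q k).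

(* The Taylor coefficients of (c z; q)_oo and of its reciprocal. *)
Definition qexp (c : C) : ps C :=
  PS (fun k => (- c) ^+ k * q ^+ 'C(k, 2) / qfact k).
Definition qexpV (c : C) : ps C := PS (fun k => c ^+ k / qfact k).

(** Gauss's formula in convolution form, used twice: w = 1 shows that the two q-exponentials are
    inverse, and w = q^b computes the coefficients in y^b needed for [qexp_product]. *)
Lemma qexp_convol u w v a : \sum_(s < a.+1)
    ((- u) ^+ s * q ^+ 'C(s, 2) / qfact s) * (w ^+ (a - s) * u ^+ (a - s) * v / qfact (a - s))
  = u ^+ a * v / qfact a * hpoch q w 1 a.
Proof.
rewrite -gauss_binomial mulr_sumr; apply: eq_bigr => s _.
have leas : (s <= a)%N by rewrite -ltnS.
rewrite -(qbin_hpoch q leas).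
have -> : u ^+ a = u ^+ s * u ^+ (a - s) by rewrite -exprD subnKC.
have qb0 : qbin q a s != 0.
  have := qfact_neq0 a; rewrite -(qbin_hpoch q leas) mulf_eq0 negb_or.
  by case/andP.
rewrite exprNn; move: (qfact_neq0 s) (qfact_neq0 (a - s)) qb0.
move: (qbin _ _ _) (hpoch _ _ _ _) (hpoch _ _ _ _) => B x y x0 y0 B0.
by field; rewrite x0 y0 B0.
Qed.

Lemma qexpK c : qexp c * qexpV c = 1.
Proof.
apply: ps_ext => a; rewrite pscM psc1.
have := qexp_convol c 1 1 a.
under eq_bigr do rewrite expr1n mul1r mulr1.
move=> ->; case: a => [|a]; first by rewrite !hpoch0 expr0 invr1 !mulr1.
by rewrite (hpochSl q 1 1) subrr mul0r mulr0.
Qed.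

Lemma qexp_shift c : qexp c = (1 - psC c * psX C) * qexp (c * q).
Proof.
rewrite mulrBl mul1r; apply: ps_ext => k; rewrite -mulrA.
transitivity (psc (qexp (c * q)) k - psc (psC c * (psX C ^+ 1 * qexp (c * q))) k); last by [].
rewrite pscCM pscXnM; case: k => [|k] /=.
  by rewrite !expr0 mulr0 subr0.
rewrite subSS subn0 -[- (c * q)]mulNr !exprMn binS bin1 hpochS -exprS exprD.
have := qfact_neq0 k.+1; rewrite hpochS -exprS mulf_eq0 negb_or.
case/andP => qf0 qk0; rewrite (exprS (- c)) (exprS q).
rewrite exprS in qk0; move: qf0 qk0.
move: (hpoch _ _ _ _) (q ^+ k) (q ^+ _) ((- c) ^+ k) => x u v w x0 u0.
by field; rewrite x0 u0.
Qed.

Lemma qexp_shiftn c k :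
  qexp c = hpoch (psC q) 1 (psC c * psX C) k * qexp (c * q ^+ k).
Proof.
elim: k => [|k IHk]; first by rewrite hpoch0 mul1r mulr1.
rewrite {}IHk qexp_shift hpochS -!mulrA -exprSr; congr (_ * (_ * _)).
by rewrite rmorphM rmorphXn; congr (1 - _); ring.
Qed.

Lemma hpoch_qpow a b : (a <= b)%N ->
  hpoch q (q ^+ b) 1 a * qfact (b - a) = (-1) ^+ a * q ^+ 'C(a, 2) * qfact b.
Proof.
elim: a => [|a IHa] ltab; first by rewrite hpoch0 bin0n subn0 !mul1r.
rewrite exprS binS bin1 exprD.
transitivity (- q ^+ a * ((-1) ^+ a * q ^+ 'C(a, 2) * hpoch q 1 q b)); last by ring.
rewrite -IHa ?(ltnW ltab) // hpochS (_ : (b - a = (b - a.+1).+1)%N); last by lia.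
rewrite [in RHS]hpochS (_ : q ^+ b = q ^+ a * (q * q ^+ (b - a.+1))); first by ring.
by rewrite -exprS -exprD; congr (_ ^+ _); lia.
Qed.

Lemma hpoch_qpow_eq0 a b : (b < a)%N -> hpoch q (q ^+ b) 1 a = 0.
Proof.
move=> ltba; rewrite -(subnKC ltba) hpochD hpochS mul1r subrr mulr0 mul0r.
by [].
Qed.

(** It suffices to multiply the double series by phi(u x). By [qexp_convol] its coefficient at x^a
    y^b then carries the product (q^b - 1) ... (q^b - q^(a-1)); this vanishes for b < a, in
    accordance with a series in x y and y. *)
Lemma qexp_product u v :
  inL (qexp (u * v)) * (inx (qexpV u) * iny (qexpV v))
  = PS (fun a => PS (fun b => q ^+ (a * b) * u ^+ a * v ^+ b / (qfact a * qfact b))).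
Proof.
set T := PS _.
suff eqT : inx (qexp u) * T = inL (qexp (u * v)) * iny (qexpV v).
  rewrite mulrCA -eqT mulrA -rmorphM mulrC [qexpV u * _]mulrC qexpK.
  by rewrite rmorph1 mulr1.
apply: psc2_ext => a b; rewrite psc2_inxM mulrC.
transitivity (psc2 (inL (qexp (u * v)) * iny (qexpV v)) a b); last by rewrite mulrC.
have -> : psc2 (inL (qexp (u * v)) * iny (qexpV v)) a b
    = if (a <= b)%N then psc (qexp (u * v)) a * psc (qexpV v) (b - a) else 0.
  rewrite mulrC /psc2 pscCM psc_inL mulrCA pscCM [qexpV v * _]mulrC pscXnM.
  by case: ifP; rewrite ?mulr0.
transitivity (u ^+ a * (v ^+ b / qfact b) / qfact a * hpoch q (q ^+ b) 1 a).
  rewrite -qexp_convol; apply: eq_bigr => s _; rewrite /psc2 /= -exprM.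
  by rewrite [(b * _)%N]mulnC !mulrA invfM; ring.
case: leqP => [leab | ltba]; last by rewrite hpoch_qpow_eq0 // mulr0.
have -> : hpoch q (q ^+ b) 1 a = (-1) ^+ a * q ^+ 'C(a, 2) * qfact b / qfact (b - a).
  by rewrite -hpoch_qpow // mulfK.
have -> : v ^+ b = v ^+ a * v ^+ (b - a) by rewrite -exprD subnKC.
rewrite /= (exprNn (u * v)) exprMn; move: (qfact_neq0 a) (qfact_neq0 b) (qfact_neq0 (b - a)).
move: (hpoch _ _ _ a) (hpoch _ _ _ b) (hpoch _ _ _ (b - a)) => x y z x0 y0 z0.
by field; rewrite x0 y0 z0.
Qed.

(** The exponent t(i + a - b) equals t(i) + (i+1) a - i b + 'C(a, 2) + 'C(b, 2) - a b. Its term - a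
    b cancels the coupling q^(a b) of [qexp_product], so the double series factors. *)
Lemma borel_qexp i c e :
  borel q i (inL (qexp (c * e)) * (inx (qexpV c) * iny (qexpV e)))
  = cstxy (q ^ tri i) * (inx (qexp (- c * q ^ (i + 1))) * iny (qexp (- e * q ^ (- i)))).
Proof.
rewrite qexp_product; apply: psc2_ext => a b.
rewrite psc2_borel psc2_cstxyM.
have -> : psc2 (inx (qexp (- c * q ^ (i + 1))) * iny (qexp (- e * q ^ (- i)))) a b
   = psc (qexp (- c * q ^ (i + 1))) a * psc (qexp (- e * q ^ (- i))) b.
  by rewrite mulrC /psc2 pscCM mulrC pscCM.
rewrite /psc2 /= !mulNr !opprK !exprMn.
have -> : q ^ tri (i + a%:Z - b%:Z) = q ^ tri i * (q ^ (i + 1)) ^+ a * (q ^ (- i)) ^+ b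
    * q ^+ 'C(a, 2) * q ^+ 'C(b, 2) / q ^+ (a * b).
  apply: (mulIf (expf_neq0 (a * b) q0)); rewrite mulfVK ?expf_neq0 //.
  rewrite !exprnP !exprz_exp -!expfzDr //; congr (_ ^ _).
  have := tri2 i; have := tri2 (i + a%:Z - b%:Z); have := bin2_double a.
  have := bin2_double b; rewrite PoszM; move: (tri _) (tri _) ('C(a, 2)%:Z) => x y z.
  by lia.
rewrite invfM; field.
by rewrite !qfact_neq0 expf_neq0.
Qed.

End QExponential.

Lemma triangle_sum (A : nmodType) N (F : nat -> nat -> A) :
  \sum_(J < N.+1) \sum_(k < J.+1) F k J
  = \sum_(k < N.+1) \sum_(l < (N - k).+1) F k (k + l)%N.
Proof.
elim: N => [|N IHN]; first by rewrite !big_ord_recl !big_ord0.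
rewrite big_ord_recr IHN /= [X in _ + X]big_ord_recr /= addrA.
rewrite [RHS]big_ord_recr /= subnn [X in _ = _ + X]big_ord1 addn0; congr (_ + _).
rewrite -big_split; apply: eq_bigr => k _ /=.
have leN : (k <= N)%N by rewrite -ltnS.
by rewrite (subSn leN) [RHS]big_ord_recr /= addnS subnKC.
Qed.

(* The numerator of the hypergeometric block: with L = q z and bi = 1 / be,
   RHG is Rnum divided by L^(J - I) (bi)_(N - I) (L - q) ... (L - q^N). *)
Definition Rnum (A : comNzRingType) (q al be bi L : A) (N I J : nat) : A :=
  \sum_(k < J.+1)
    qbin q (N - I) k * hpoch q L (q * al) (N - I - k) * hpoch q L (q ^+ (N - k).+1) k
    * hpoch q (q * al * be) L k
    * (bi ^+ J * qbin q (N - k) (J - k) * hpoch q 1 bi (N - J)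
       * hpoch q L (q * be) (J - k)).

Lemma rmorph_Rnum (A B : comNzRingType) (g : {rmorphism A -> B}) q al be bi L N I J :
  g (Rnum q al be bi L N I J) = Rnum (g q) (g al) (g be) (g bi) (g L) N I J.
Proof.
rewrite rmorph_sum; apply: eq_bigr => k _.
by rewrite !(rmorphM, rmorph_hpoch, rmorph_qbin, rmorphXn, rmorph1).
Qed.

(** The order of the factors is reversed: c q^(k-1-s) is the inverse of c' q^s, so w - c' q^s = - c'
    q^s (1 - c q^(k-1-s) w). Only the scalars c and c' are inverted, never w. *)
Lemma hpoch_rev (C : fieldType) (A : comNzRingType) (io : {rmorphism C -> A})
    (q : C) w c c' k : q != 0 -> c * c' * q ^+ k = q ->
  hpoch (io q) w (io c') k
  = io ((- c') ^+ k * q ^+ 'C(k, 2)) * hpoch (io q) 1 (io c * w) k.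
Proof.
move=> q0 cc'; have -> : (- c') ^+ k * q ^+ 'C(k, 2) = \prod_(s < k) - (c' * q ^+ s).
  elim: k {cc'} => [|k IHk]; first by rewrite big_ord0 bin0n !expr0 mulr1.
  by rewrite big_ord_recr /= -IHk exprS binS bin1 exprD; ring.
rewrite /hpoch [X in _ = _ * X](reindex_inj rev_ord_inj) /= rmorph_prod -big_split /=.
apply: eq_bigr => s _; rewrite rmorphN rmorphM rmorphXn.
have eqk : c * q ^+ (k - s.+1) * (c' * q ^+ s) = 1.
  apply: (mulIf q0); rewrite mul1r -[RHS]cc'.
  transitivity (c * c' * (q ^+ (k - s.+1) * q ^+ s.+1)); first by rewrite exprSr; ring.
  by rewrite -exprD subnK.
have := congr1 io eqk; rewrite !(rmorphM, rmorphXn) rmorph1 => eqk'.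
transitivity (- (io c' * io q ^+ s)
  + w * (io c * io q ^+ (k - s.+1) * (io c' * io q ^+ s))).
  by rewrite eqk' mulr1 addrC.
by ring.
Qed.

(** * The finite connection identity *)

Section FiniteIdentity.
Variables (C : fieldType) (q : C) (A : comNzRingType) (io : {rmorphism C -> A}).
Hypothesis q0 : q != 0.
Notation Q := (io q).

Variables (m n : nat) (d1 d4 : C) (x y : A).
Hypotheses (d10 : d1 != 0) (d40 : d4 != 0).
Let N := (m + n)%N.
Let L := x * y.
Variables al be bi : C.
Hypotheses (alE : al = q ^+ n / d1) (beE : be = q ^+ m / d4) (biE : bi = d4 / q ^+ m).

Let beK : be * bi = 1.
Proof. by rewrite beE biE; field; rewrite d40 expf_neq0. Qed.

Lemma inner_sum k : (k <= N)%N ->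
  \sum_(l < (N - k).+1)
    io (bi ^+ (k + l) * hpoch q 1 bi (N - (k + l)) * q ^ (- tri ((k + l)%N%:Z - n%:Z)))
    * qbin Q (N - k) l * hpoch Q L (Q * io be) l * y ^+ (N - (k + l))
    * hpoch Q 1 (io (- q ^- m) * x) (N - (k + l))
    * hpoch Q 1 (io (- q ^- n) * y) (k + l)
  = io (bi ^+ N * q ^ (- (N - k)%N%:Z - tri (k%:Z - n%:Z)))
    * hpoch Q 1 (io (- q ^- n) * y) k * hpoch Q y (io (- (q / d4))) (N - k)
    * hpoch Q L Q (N - k).
Proof.
move=> lekN; set M := (N - k)%N.
pose kap := (-1) ^+ M * bi ^+ N * q ^ ('C(M, 2)%:Z - tri (k%:Z - n%:Z)).
have MN : (M%:Z = m%:Z + n%:Z - k%:Z)%R by rewrite /M /N; lia.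
have qM : q ^ (- M%:Z) = q ^- m * q ^ (k%:Z - n%:Z).
  by rewrite MN exprnN -expfzDr //; congr (_ ^ _); lia.
have q1M : q ^ (1 - M%:Z) = q * q ^ (- M%:Z) by rewrite expfzDr.
have qmbe : q * be * q ^- m = q / d4 by rewrite beE; field; rewrite d40 expf_neq0.
(* Here a = q be / L, b = - q^(k-n) y and e = - q^(-m) x. Then a b e = q^(1-M) be is a scalar, so
   the corresponding product can come, reversed, from the factor (bi)_(N-J). *)
have saal : \sum_(l < M.+1) qbin Q M l * hpoch Q L (io (q * be)) l
      * hpoch Q 1 (io (- q ^ (k%:Z - n%:Z)) * y) l * io (- q ^- m) ^+ l
      * hpoch Q 1 (io (q ^ (1 - M%:Z) * be) * Q ^+ l) (M - l)
      * hpoch Q y (io (- q ^- m) * L) (M - l)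
    = hpoch Q y (io (- (q / d4))) M * hpoch Q 1 (io (q ^ (- M%:Z)) * L) M.
  by apply: saalschuetz; rewrite ?q1M ?qM -?qmbe; ring.
transitivity (io kap * hpoch Q 1 (io (- q ^- n) * y) k
    * (hpoch Q y (io (- (q / d4))) M * hpoch Q 1 (io (q ^ (- M%:Z)) * L) M)); last first.
  rewrite (@hpoch_rev _ _ io q L (q ^ (- M%:Z)) q M) //; last first.
    by rewrite mulrAC exprnP -expfzDr // addNr mul1r.
  have -> : kap = (bi ^+ N * q ^ (- M%:Z - tri (k%:Z - n%:Z))) * ((- q) ^+ M * q ^+ 'C(M, 2)).
    rewrite /kap (exprNn q).
    have -> : q ^ ('C(M, 2)%:Z - tri (k%:Z - n%:Z))
        = q ^ (- M%:Z - tri (k%:Z - n%:Z)) * (q ^+ M * q ^+ 'C(M, 2)).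
      by rewrite !exprnP -!expfzDr //; congr (_ ^ _); lia.
    by ring.
  by rewrite rmorphM; ring.
rewrite -saal mulr_sumr; apply: eq_bigr => -[l ltlM] _ /=.
have leR : (l <= M)%N by rewrite -ltnS.
have [R defM] : exists R, M = (l + R)%N by exists (M - l)%N; rewrite subnKC.
have eR : (M - l = R)%N by rewrite defM addKn.
have eR' : (N - (k + l) = R)%N by rewrite subnDA -/M eR.
rewrite eR eR'.
have -> : hpoch Q y (io (- q ^- m) * L) R = y ^+ R * hpoch Q 1 (io (- q ^- m) * x) R.
  by rewrite -hpochZ mulr1; congr hpoch; rewrite /L; ring.
rewrite hpochD.
have -> : io (- q ^- n) * y * Q ^+ k = io (- q ^ (k%:Z - n%:Z)) * y.
  rewrite -rmorphXn mulrAC -rmorphM mulNr; congr (io (- _) * _).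
  by rewrite expfzDr // mulrC exprnN.
have -> : hpoch Q 1 (io (q ^ (1 - M%:Z) * be) * Q ^+ l) R
    = io (hpoch q 1 (q ^ (1 - M%:Z) * be * q ^+ l) R).
  by rewrite rmorph_hpoch rmorph1 [in RHS]rmorphM rmorphXn.
have -> : hpoch q 1 bi R
    = (- bi) ^+ R * q ^+ 'C(R, 2) * hpoch q 1 (q ^ (1 - M%:Z) * be * q ^+ l) R.
  have := @hpoch_rev _ _ idfun q 1 (q ^ (1 - M%:Z) * be * q ^+ l) bi R q0.
  rewrite /= mulr1; apply.
  transitivity (q ^ (1 - M%:Z) * (q ^+ l * q ^+ R) * (be * bi)); first by ring.
  by rewrite beK mulr1 -exprD -defM exprnP -expfzDr // subrK.
have -> : io (- q ^- m) ^+ l = io ((- q ^- m) ^+ l) by rewrite rmorphXn.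
have kapE : bi ^+ (k + l) * ((- bi) ^+ R * q ^+ 'C(R, 2)) * q ^ (- tri ((k + l)%N%:Z - n%:Z))
   = kap * (- q ^- m) ^+ l.
  have eN : N = (k + l + R)%N by rewrite -addnA -defM subnKC.
  rewrite /kap eN defM !(exprD _ _ R) (exprNn bi) (exprNn (q ^- m)).
  have -> : q ^ ('C(l + R, 2)%:Z - tri (k%:Z - n%:Z))
      = q ^+ 'C(R, 2) * q ^ (- tri ((k + l)%N%:Z - n%:Z)) * q ^ (m%:Z * l%:Z).
    rewrite !exprnP -!expfzDr //; congr (_ ^ _).
    have := tri2 ((k + l)%N%:Z - n%:Z); have := tri2 (k%:Z - n%:Z).
    have := bin2_double (l + R); have := bin2_double R.
    have -> : m%:Z = k%:Z + l%:Z + R%:Z - n%:Z by lia.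
    move: (tri _) (tri _) ('C(R, 2)%:Z) ('C(_, 2)%:Z) => t1 t2 t3 t4.
    by rewrite !PoszD; lia.
  have -> : (q ^- m) ^+ l = (q ^ (m%:Z * l%:Z))^-1 by rewrite exprVn -exprM.
  have := expfz_neq0 (m%:Z * l%:Z) q0; move: (q ^ (m%:Z * l%:Z)) => u u0.
  transitivity ((-1) ^+ l * (-1) ^+ l * (bi ^+ (k + l) * ((-1) ^+ R * bi ^+ R * q ^+ 'C(R, 2))
     * q ^ (- tri ((k + l)%N%:Z - n%:Z)))).
    by rewrite -expr2 sqrr_sign mul1r.
  by field.
move: (hpoch q 1 _ R) => h.
transitivity (io (bi ^+ (k + l) * ((- bi) ^+ R * q ^+ 'C(R, 2))
   * q ^ (- tri ((k + l)%N%:Z - n%:Z))) * io h * qbin Q M l * hpoch Q L (io (q * be)) l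
   * y ^+ R * hpoch Q 1 (io (- q ^- m) * x) R
   * (hpoch Q 1 (io (- q ^- n) * y) k * hpoch Q 1 (io (- q ^ (k%:Z - n%:Z)) * y) l)).
  by rewrite -!rmorphM; congr (io _ * _ * _ * _ * _ * _); ring.
rewrite kapE rmorphM.
move: (hpoch _ _ _ k) (hpoch _ _ _ R) (hpoch _ L _ _) => h1 h2 h3.
move: (hpoch _ _ _ l) (qbin _ _ _) => h4 h5.
by ring.
Qed.

Lemma outer_sum I : (I <= N)%N ->
  \sum_(k < (N - I).+1)
    qbin Q (N - I) k * hpoch Q L (Q * io al) (N - I - k)
    * hpoch Q (Q * io al * io be) L k
    * io (q ^ (- (N - k)%N%:Z - tri (k%:Z - n%:Z)))
    * hpoch Q 1 (io (- q ^- n) * y) k * hpoch Q y (io (- (q / d4))) (N - k)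
  = io (be ^+ (N - I) * q ^ (- m%:Z - tri (I%:Z - m%:Z)) * hpoch q 1 bi (N - I))
    * hpoch Q y (io (- (q / d4))) I * hpoch Q L (io (- (q / d1)) * y) (N - I).
Proof.
move=> leIN; set M := (N - I)%N.
have qal : q * al * q ^- n = q / d1 by rewrite alE; field; rewrite d10 expf_neq0.
(* Here a = bi L / (q al), b = - q^(-n) y and e = q al / L, hence a b e = - bi q^(-n) y and a e =
   bi. *)
have saal : \sum_(k < M.+1) qbin Q M k * hpoch Q (io (q * al)) (io bi * L) k
      * hpoch Q 1 (io (- q ^- n) * y) k * 1 ^+ k
      * hpoch Q 1 (io bi * (io (- q ^- n) * y) * Q ^+ k) (M - k)
      * hpoch Q L (io (q * al)) (M - k)
    = hpoch Q 1 (io bi) M * hpoch Q L (io (- (q / d1)) * y) M.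
  by apply: saalschuetz; rewrite -?qal; ring.
rewrite rmorphM rmorph_hpoch rmorph1.
transitivity (io (be ^+ M * q ^ (- m%:Z - tri (I%:Z - m%:Z))) * hpoch Q y (io (- (q / d4))) I
  * (hpoch Q 1 (io bi) M * hpoch Q L (io (- (q / d1)) * y) M)); last by ring.
rewrite -saal mulr_sumr; apply: eq_bigr => -[k ltkM] _ /=.
have [R defM] : exists R, M = (k + R)%N by exists (M - k)%N; rewrite subnKC.
have eR : (M - k = R)%N by rewrite defM addKn.
have eNk : (N - k = I + R)%N by rewrite -(subnKC leIN) -/M defM; lia.
have mE : m%:Z = (I%:Z + k%:Z + R%:Z - n%:Z)%R.
  by have := subnKC leIN; rewrite -/M defM /N; lia.
rewrite eR eNk hpochD expr1n.
have -> : hpoch Q (Q * io al * io be) L k = io (be ^+ k) * hpoch Q (io (q * al)) (io bi * L) k.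
  rewrite rmorphXn -hpochZ; congr hpoch; first by ring.
  by rewrite mulrA -rmorphM beK rmorph1 mul1r.
(* The first I factors are free of k. The other R = N - I - k factors, reversed, form the product
   with parameter a b e. *)
have -> : hpoch Q y (io (- (q / d4)) * Q ^+ I) R
   = io ((be * q ^ (1 - m%:Z + I%:Z)) ^+ R * q ^+ 'C(R, 2))
     * hpoch Q 1 (io bi * (io (- q ^- n) * y) * Q ^+ k) R.
  have qI : q / d4 * q ^+ I = be * q ^ (1 - m%:Z + I%:Z).
    rewrite !expfzDr // expr1z -exprnN -!exprnP beE; field.
    by rewrite d40 expf_neq0.
  have -> : io (- (q / d4)) * Q ^+ I = io (- (be * q ^ (1 - m%:Z + I%:Z))).
    by rewrite -rmorphXn -rmorphM mulNr qI.
  rewrite (@hpoch_rev _ _ io q y (- (bi * q ^- n * q ^+ k)) _ R) // ?opprK.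
    by congr (_ * hpoch _ _ _ _); rewrite rmorphN !rmorphM rmorphXn rmorphN; ring.
  rewrite mulrNN.
  transitivity (be * bi * (q ^ (1 - m%:Z + I%:Z) * (q ^- n * q ^+ k * q ^+ R))).
    by ring.
  rewrite beK mul1r !exprnN !exprnP -!expfzDr // -[RHS]expr1z; congr (_ ^ _).
  by rewrite mE; lia.
have cE : q ^ (- (I + R)%N%:Z - tri (k%:Z - n%:Z)) * be ^+ k
    * ((be * q ^ (1 - m%:Z + I%:Z)) ^+ R * q ^+ 'C(R, 2))
   = be ^+ M * q ^ (- m%:Z - tri (I%:Z - m%:Z)).
  rewrite defM (exprMn _ be) exprD.
  have -> : q ^ (- m%:Z - tri (I%:Z - m%:Z)) = q ^ (- (I + R)%N%:Z - tri (k%:Z - n%:Z))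
     * ((q ^ (1 - m%:Z + I%:Z)) ^+ R * q ^+ 'C(R, 2)).
    rewrite !exprnP exprz_exp -!expfzDr //; congr (_ ^ _).
    have := tri2 (k%:Z - n%:Z); have := tri2 (I%:Z - m%:Z); have := bin2_double R.
    move: (tri _) (tri _) ('C(R, 2)%:Z) => t1 t2 t3.
    by rewrite !PoszD mE; lia.
  by ring.
rewrite -cE !rmorphM.
move: (hpoch _ _ _ I) (hpoch _ _ _ R) (hpoch _ _ _ R) => h1 h2 h3.
move: (qbin _ _ _) (hpoch _ _ _ k) (hpoch _ _ _ k) => h4 h5 h6.
by ring.
Qed.

(** The scalar in front of [Rnum] is the row normalization with I = i + n. After division by x^i,
    the power x^(J-I) meets the factor L^(I-J) of the block and leaves y^(I-J); multiplication by
    y^N makes the exponent nonnegative. *)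
Lemma finite_identity I : (I <= N)%N ->
  \sum_(J < N.+1)
    io (d1 ^+ (N - I) * q ^ ((m%:Z + 1) * (I%:Z - n%:Z)))
    * Rnum Q (io al) (io be) (io bi) L N I J * y ^+ (N + I - J)
    * io (q ^ (- tri (J%:Z - n%:Z)))
    * (hpoch Q 1 (io (- q ^- m) * x) (N - J) * hpoch Q 1 (io (- q ^- n) * y) J)
  = y ^+ N * io (hpoch q 1 bi (N - I)) * hpoch Q L Q N
    * io (q ^ tri (I%:Z - n%:Z))
    * (hpoch Q 1 (io (- d1 * q ^ (I%:Z - N%:Z)) * x) (N - I)
       * hpoch Q 1 (io (- d4 * q ^ (- I%:Z)) * y) I).
Proof.
move=> leIN; set M := (N - I)%N; set kap := d1 ^+ M * _.
transitivity (io kap * y ^+ I * \sum_(J < N.+1) \sum_(k < J.+1)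
  qbin Q M k * hpoch Q L (Q * io al) (M - k) * hpoch Q L (Q ^+ (N - k).+1) k
  * hpoch Q (Q * io al * io be) L k
  * (io (bi ^+ J * hpoch q 1 bi (N - J) * q ^ (- tri (J%:Z - n%:Z)))
    * qbin Q (N - k) (J - k) * hpoch Q L (Q * io be) (J - k) * y ^+ (N - J)
    * hpoch Q 1 (io (- q ^- m) * x) (N - J)
    * hpoch Q 1 (io (- q ^- n) * y) J)).
  rewrite mulr_sumr; apply: eq_bigr => -[J ltJN] _ /=.
  have -> : (N + I - J = I + (N - J))%N by lia.
  rewrite exprD /Rnum -/M !(mulr_sumr, mulr_suml); apply: eq_bigr => k _.
  rewrite !rmorphM !rmorphXn rmorph_hpoch rmorph1.
  move: (qbin _ _ _) (qbin _ _ _) => h1 h2.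
  move: (hpoch _ _ _ (M - k)) (hpoch _ _ _ (J - k)) => h3 h4.
  move: (hpoch _ _ _ _) (hpoch _ _ _ _) (hpoch _ _ _ _) => h5 h6 h7.
  move: (hpoch _ _ _ _) (hpoch _ _ _ _) => h8 h9.
  by ring.
rewrite (triangle_sum _ (fun k J => qbin Q M k * hpoch Q L (Q * io al) (M - k)
  * hpoch Q L (Q ^+ (N - k).+1) k * hpoch Q (Q * io al * io be) L k
  * (io (bi ^+ J * hpoch q 1 bi (N - J) * q ^ (- tri (J%:Z - n%:Z)))
    * qbin Q (N - k) (J - k) * hpoch Q L (Q * io be) (J - k) * y ^+ (N - J)
    * hpoch Q 1 (io (- q ^- m) * x) (N - J)
    * hpoch Q 1 (io (- q ^- n) * y) J))).
transitivity (io kap * y ^+ I * \sum_(k < N.+1) io (bi ^+ N) * hpoch Q L Q N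
  * (qbin Q M k * hpoch Q L (Q * io al) (M - k) * hpoch Q (Q * io al * io be) L k
    * io (q ^ (- (N - k)%N%:Z - tri (k%:Z - n%:Z)))
    * hpoch Q 1 (io (- q ^- n) * y) k * hpoch Q y (io (- (q / d4))) (N - k))).
  congr (_ * _); apply: eq_bigr => -[k ltkN] _ /=; rewrite -mulr_sumr.
  under eq_bigr do rewrite addKn.
  rewrite inner_sum -1?ltnS //.
  (* The factor of [Rnum] in q^(N-k+1), ..., q^N completes the product left by [inner_sum] to (L -
     q) ... (L - q^N), which is free of k. *)
  have -> : hpoch Q L Q N = hpoch Q L Q (N - k) * hpoch Q L (Q ^+ (N - k).+1) k.
    by rewrite exprS -hpochD subnK -1?ltnS.
  rewrite rmorphM; move: (hpoch _ _ _ _) (hpoch _ _ _ _) (hpoch _ _ _ _) => h1 h2 h3.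
  move: (hpoch _ _ _ _) (hpoch _ _ _ _) (hpoch _ _ _ _) (qbin _ _ _) => h4 h5 h6 h7.
  by ring.
rewrite -mulr_sumr (_ : \sum_(k < N.+1) _ = \sum_(k < M.+1)
   qbin Q M k * hpoch Q L (Q * io al) (M - k) * hpoch Q (Q * io al * io be) L k
    * io (q ^ (- (N - k)%N%:Z - tri (k%:Z - n%:Z)))
    * hpoch Q 1 (io (- q ^- n) * y) k * hpoch Q y (io (- (q / d4))) (N - k)); last first.
  rewrite (@big_ord_widen _ _ _ M.+1 N.+1 (fun k => qbin Q M k * hpoch Q L (Q * io al) (M - k)
    * hpoch Q (Q * io al * io be) L k * io (q ^ (- (N - k)%N%:Z - tri (k%:Z - n%:Z)))
    * hpoch Q 1 (io (- q ^- n) * y) k * hpoch Q y (io (- (q / d4))) (N - k)));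
    last by rewrite ltnS; exact: leq_subr.
  rewrite [RHS]big_mkcond; apply: eq_bigr => k _; case: ltnP => // ltMk.
  by rewrite qbin_small // !mul0r.
rewrite outer_sum //.
have -> : hpoch Q L (io (- (q / d1)) * y) (N - I)
    = y ^+ M * (io ((q / d1) ^+ M * q ^+ 'C(M, 2))
      * hpoch Q 1 (io (- d1 * q ^ (I%:Z - N%:Z)) * x) M).
  have -> : hpoch Q L (io (- (q / d1)) * y) (N - I) = y ^+ M * hpoch Q x (io (- (q / d1))) M.
    by rewrite -hpochZ /L (mulrC x) (mulrC _ y).
  rewrite (@hpoch_rev _ _ io q x (- d1 * q ^ (I%:Z - N%:Z)) (- (q / d1)) M) ?opprK //.
  have -> : q ^ (I%:Z - N%:Z) = q ^- M.
    by rewrite exprnN; congr (_ ^ _); rewrite /M; lia.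
  by field; rewrite d10 expf_neq0.
have -> : hpoch Q y (io (- (q / d4))) I
   = io ((q / d4) ^+ I * q ^+ 'C(I, 2)) * hpoch Q 1 (io (- d4 * q ^ (- I%:Z)) * y) I.
  rewrite (@hpoch_rev _ _ io q y (- d4 * q ^ (- I%:Z)) (- (q / d4)) I) ?opprK //.
  by rewrite -exprnN; field; rewrite d40 expf_neq0.
have -> : y ^+ N = y ^+ I * y ^+ M by rewrite -exprD subnKC.
(* The scalars collected from both summations and both reversals. *)
have cE : kap * bi ^+ N * (be ^+ M * q ^ (- m%:Z - tri (I%:Z - m%:Z)))
    * ((q / d4) ^+ I * q ^+ 'C(I, 2)) * ((q / d1) ^+ M * q ^+ 'C(M, 2))
    = q ^ tri (I%:Z - n%:Z).
  have biN : bi ^+ N * be ^+ M = (d4 / q ^+ m) ^+ I.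
    rewrite -(subnKC leIN) exprD -/M -mulrA -exprMn (mulrC bi) beK expr1n mulr1.
    by rewrite biE.
  transitivity (d1 ^+ M * q ^ ((m%:Z + 1) * (I%:Z - n%:Z)) * (bi ^+ N * be ^+ M)
    * q ^ (- m%:Z - tri (I%:Z - m%:Z)) * ((q / d4) ^+ I * q ^+ 'C(I, 2))
    * ((q / d1) ^+ M * q ^+ 'C(M, 2))); first by rewrite /kap; ring.
  rewrite biN.
  transitivity (q ^ ((m%:Z + 1) * (I%:Z - n%:Z)) * q ^ (- m%:Z - tri (I%:Z - m%:Z))
    * (q ^+ I * q ^+ 'C(I, 2)) * (q ^+ M * q ^+ 'C(M, 2)) * (q ^- m) ^+ I).
    rewrite !exprMn !exprVn; field.
    by rewrite !expf_neq0.
  have mE : m%:Z = (I%:Z + M%:Z - n%:Z)%R.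
    by have := subnKC leIN; rewrite -/M /N; lia.
  rewrite exprnN !exprnP exprz_exp -!expfzDr //; congr (_ ^ _).
  have := tri2 (I%:Z - n%:Z); have := tri2 (I%:Z - m%:Z).
  have := bin2_double I; have := bin2_double M.
  move: (tri _) (tri _) ('C(M, 2)%:Z) ('C(I, 2)%:Z) => t1 t2 t3 t4.
  by rewrite mE; lia.
rewrite -cE !rmorphM -/M; move: (hpoch q 1 bi M) => h.
move: (hpoch Q L Q N) (hpoch _ _ _ M) (hpoch _ _ _ I) => h1 h2 h3.
by ring.
Qed.

End FiniteIdentity.

(** * The operator H_S on monomials *)

Section ShakirovSeries.
Variables (C : fieldType) (q : C).
Hypotheses (q0 : q != 0) (qfact_neq0 : forall k, hpoch q 1 q k != 0).
Notation Q := (cstxy q).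
Notation x := (varx C).
Notation y := (vary C).

Lemma qexp_ratio_x c k :
  inx (qexpV q (c * q ^+ k)) * inx (qexp q c) = hpoch Q 1 (cstxy c * x) k.
Proof.
rewrite (qexp_shiftn qfact_neq0 c k) rmorphM mulrCA -rmorphM (mulrC (qexpV _ _)).
rewrite (qexpK qfact_neq0) rmorph1 mulr1 rmorph_hpoch rmorph1 rmorphM.
by rewrite /= !inx_C inx_X.
Qed.

Lemma qexp_ratio_y c k :
  iny (qexpV q (c * q ^+ k)) * iny (qexp q c) = hpoch Q 1 (cstxy c * y) k.
Proof.
rewrite (qexp_shiftn qfact_neq0 c k) rmorphM mulrCA -rmorphM (mulrC (qexpV _ _)).
by rewrite (qexpK qfact_neq0) rmorph1 mulr1 rmorph_hpoch rmorph1 rmorphM.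
Qed.

Lemma qexpV_shift_x c k :
  inx (qexpV q c) * hpoch Q 1 (cstxy c * x) k = inx (qexpV q (c * q ^+ k)).
Proof.
rewrite -qexp_ratio_x mulrCA -rmorphM (mulrC (qexpV _ _)).
by rewrite (qexpK qfact_neq0) rmorph1 mulr1.
Qed.

Lemma qexpV_shift_y c k :
  iny (qexpV q c) * hpoch Q 1 (cstxy c * y) k = iny (qexpV q (c * q ^+ k)).
Proof.
rewrite -qexp_ratio_y mulrCA -rmorphM (mulrC (qexpV _ _)).
by rewrite (qexpK qfact_neq0) rmorph1 mulr1.
Qed.

(* x^(-i) H_S x^i, as an element of C[[x, y]]. *)
Definition HSser d1 d2 d3 d4 i : ps (ps C) :=
  inx (qexpV q q) * (iny (qexpV q 1) * borel q i
      (inL (qexp q 1) * (inL (qexp q (q^-1 * d1 * d2 * d3 * d4))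
       * (inx (qexpV q (- d1)) * (inx (qexpV q (- d2))
         * (iny (qexpV q (- d3)) * (iny (qexpV q (- d4))
       * borel q i (inx (qexpV q (q^-1 * d1 * d2)) * (iny (qexpV q (d3 * d4)) * 1))))))))).

Variables (m n : nat) (d1 d4 : C).
Hypotheses (d10 : d1 != 0) (d40 : d4 != 0).
Let N := (m + n)%N.
Variables al be bi : C.
Hypotheses (alE : al = q ^+ n / d1) (beE : be = q ^+ m / d4) (biE : bi = d4 / q ^+ m).

(** The inner transform is [borel_qexp] with c = d1 d2 / q and e = d3 d4. Because d2 and d3 are
    negative powers of q, its value differs from phi(- d1 x) phi(- d4 y) by finitely many factors
    only, and the quotient is a polynomial in x and y. *)
Lemma HSser_borel I : (I <= N)%N ->
  HSser d1 (q ^- m) (q ^- n) d4 (I%:Z - n%:Z)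
  = inx (qexpV q q) * iny (qexpV q 1) * borel q (I%:Z - n%:Z)
      (inL (qexp q 1) * (inx (qexpV q (- q ^- m)) * iny (qexpV q (- q ^- n)))
       * (cstxy (q ^ tri (I%:Z - n%:Z))
          * (hpoch Q 1 (cstxy (- d1 * q ^ (I%:Z - N%:Z)) * x) (N - I)
             * hpoch Q 1 (cstxy (- d4 * q ^ (- I%:Z)) * y) I))).
Proof.
move=> leIN; set i := I%:Z - n%:Z.
have eB : inL (qexp q (q^-1 * d1 * q ^- m * q ^- n * d4))
    * borel q i (inx (qexpV q (q^-1 * d1 * q ^- m)) * (iny (qexpV q (q ^- n * d4)) * 1))
  = cstxy (q ^ tri i) * (inx (qexp q (- d1 * q ^ (I%:Z - N%:Z)))
      * iny (qexp q (- d4 * q ^ (- I%:Z)))).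
  rewrite mulr1 -borel_inLM.
  have -> : q^-1 * d1 * q ^- m * q ^- n * d4 = q^-1 * d1 * q ^- m * (q ^- n * d4).
    by rewrite !mulrA.
  rewrite (borel_qexp q0 qfact_neq0).
  congr (_ * (inx (qexp q _) * iny (qexp q _))).
    have -> : q ^ (I%:Z - N%:Z) = q^-1 * q ^- m * q ^ (i + 1).
      rewrite exprnN -(exprN1 q) -!expfzDr //; congr (_ ^ _).
      by rewrite /i /N; lia.
    by ring.
  have -> : q ^ (- I%:Z) = q ^- n * q ^ (- i); last by ring.
  by rewrite exprnN -expfzDr //; congr (_ ^ _); rewrite /i; lia.
have <- : inx (qexpV q (- d1)) * inx (qexp q (- d1 * q ^ (I%:Z - N%:Z)))
    = hpoch Q 1 (cstxy (- d1 * q ^ (I%:Z - N%:Z)) * x) (N - I).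
  rewrite -qexp_ratio_x; congr (inx (qexpV q _) * _).
  by rewrite -mulrA exprnP -expfzDr // (_ : _ + _ = 0) ?mulr1 //; lia.
have <- : iny (qexpV q (- d4)) * iny (qexp q (- d4 * q ^ (- I%:Z)))
    = hpoch Q 1 (cstxy (- d4 * q ^ (- I%:Z)) * y) I.
  rewrite -qexp_ratio_y; congr (iny (qexpV q _) * _).
  by rewrite -mulrA exprnP -expfzDr // addNr mulr1.
rewrite /HSser -[RHS]mulrA; congr (_ * (_ * borel _ _ _)).
move: eB; move: (borel _ _ _) (inL (qexp q (_ * _))) => B Lw eB.
transitivity (inL (qexp q 1) * (inx (qexpV q (- d1)) * (inx (qexpV q (- q ^- m))
   * (iny (qexpV q (- q ^- n)) * iny (qexpV q (- d4))))) * (Lw * B)); first by ring.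
by rewrite eB; ring.
Qed.

(** One denominator for the whole row: 'X^N absorbs L^(J-I) for every J, so the entry is 'X^(N+I-J)
    times [num_poly I J] over [den_poly I]. *)
Definition den_poly I : {poly C} :=
  'X^N * (hpoch q 1 bi (N - I))%:P * hpoch q%:P 'X q%:P N.
Definition num_poly I J : {poly C} :=
  (d1 ^+ (N - I) * q ^ ((m%:Z + 1) * (I%:Z - n%:Z)))%:P
  * Rnum q%:P al%:P be%:P bi%:P 'X N I J.

Let g : {rmorphism {poly C} -> ps (ps C)} := @inL C \o @ps_poly C.
Let gC c : g c%:P = cstxy c. Proof. exact: inL_C. Qed.
Let gX : g 'X = x * y. Proof. exact: inL_X. Qed.

Lemma den_poly_HSser I : (I <= N)%N ->
  inL (ps_poly (den_poly I)) * HSser d1 (q ^- m) (q ^- n) d4 (I%:Z - n%:Z)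
  = \sum_(J < N.+1) inL (ps_poly (num_poly I J)) * (x ^+ N * y ^+ (N + I - J)).
Proof.
move=> leIN; rewrite HSser_borel // mulrCA -borel_inLM.
set Z := inL (qexp q 1) * _; set V := inx _ * iny _.
have -> : inL (ps_poly (den_poly I))
    = (x * y) ^+ N * cstxy (hpoch q 1 bi (N - I)) * hpoch Q (x * y) Q N.
  by rewrite -[LHS]/(g (den_poly I)) /den_poly !rmorphM rmorphXn gC (rmorph_hpoch g) gC gX.
have numE J : inL (ps_poly (num_poly I J))
    = cstxy (d1 ^+ (N - I) * q ^ ((m%:Z + 1) * (I%:Z - n%:Z)))
      * Rnum Q (cstxy al) (cstxy be) (cstxy bi) (x * y) N I J.
  by rewrite -[LHS]/(g (num_poly I J)) /num_poly rmorphM rmorph_Rnum !gC gX.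
have := @finite_identity C q _ (@cstxy C) q0 m n d1 d4 x y d10 d40 al be bi alE beE biE I leIN.
move=> fin.
(* Of the factor (x y)^N, the part y^N enters the finite identity, while x^N stays in front and
   joins y^(N+I-J). *)
transitivity (V * borel q (I%:Z - n%:Z) (x ^+ N * Z * (
   y ^+ N * cstxy (hpoch q 1 bi (N - I)) * hpoch Q (x * y) Q N
    * cstxy (q ^ tri (I%:Z - n%:Z))
    * (hpoch Q 1 (cstxy (- d1 * q ^ (I%:Z - N%:Z)) * x) (N - I)
       * hpoch Q 1 (cstxy (- d4 * q ^ (- I%:Z)) * y) I)))).
  by congr (_ * borel _ _ _); rewrite exprMn; ring.
rewrite -fin mulr_sumr borel_sum mulr_sumr; apply: eq_bigr => -[J ltJN] _ /=.
rewrite -numE {fin}.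
transitivity (V * borel q (I%:Z - n%:Z) (inL (ps_poly (num_poly I J))
  * (cstxy (q ^ (- tri (J%:Z - n%:Z))) * (x ^+ N * y ^+ (N + I - J)
  * (inL (qexp q 1)
     * ((inx (qexpV q (- q ^- m)) * hpoch Q 1 (cstxy (- q ^- m) * x) (N - J))
       * (iny (qexpV q (- q ^- n)) * hpoch Q 1 (cstxy (- q ^- n) * y) J))))))).
  by congr (_ * borel _ _ _); rewrite /Z; ring.
rewrite borel_inLM borel_cstxyM borel_monoM qexpV_shift_x qexpV_shift_y.
set j := J%:Z - n%:Z.
(* Moving x^N y^(N+I-J) out of the transform changes the base index from i to j. *)
have -> : I%:Z - n%:Z + N%:Z - (N + I - J)%N%:Z = j by rewrite /j; lia.
have -> : - q ^- m * q ^+ (N - J) = - q ^ (- j).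
  rewrite mulNr exprnN exprnP -expfzDr //; congr (- (_ ^ _)).
  by rewrite /j /N; lia.
have -> : - q ^- n * q ^+ J = - q ^ j.
  by rewrite mulNr exprnN exprnP -expfzDr // addrC.
(* The parameters - q^(-j) and - q^j have product 1, so phi(Lambda) is the numerator that
   [borel_qexp] asks for. The transform is q^t(j) phi(q x) phi(y), which [V] cancels up to the
   scalar. *)
have -> : qexp q 1 = qexp q (- q ^ (- j) * - q ^ j).
  by rewrite mulrNN -expfzDr // addNr.
rewrite (borel_qexp q0 qfact_neq0) !opprK -!expfzDr // addKr subrr.
have VK : V * (inx (qexp q q) * iny (qexp q 1)) = 1.
  rewrite /V mulrACA -!rmorphM (mulrC (qexpV q q)) (mulrC (qexpV q 1)).
  by rewrite !(qexpK qfact_neq0) !rmorph1 mulr1.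
have qtri : cstxy (q ^ (- tri j)) * cstxy (q ^ tri j) = 1.
  by rewrite -rmorphM -expfzDr // addNr rmorph1.
transitivity ((cstxy (q ^ (- tri j)) * cstxy (q ^ tri j)) * (V * (inx (qexp q q) * iny (qexp q 1)))
  * (inL (ps_poly (num_poly I J)) * (x ^+ N * y ^+ (N + I - J)))).
  by ring.
by rewrite qtri VK !mul1r.
Qed.

End ShakirovSeries.

Lemma qpochE (F : fieldType) (q a : F) k : qpoch q a k = hpoch q 1 a k.
Proof. by []. Qed.

(** * Clearing denominators in the hypergeometric block *)

Section HypergeometricBlock.
Variables (F : fieldType) (q : F).
Hypotheses (q0 : q != 0) (qfact_neq0 : forall k, hpoch q 1 q k != 0).
Notation P := (hpoch q 1).

Let hpoch_rev1 k c c' : c * c' * q ^+ k = q ->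
  P c' k = (- c') ^+ k * q ^+ 'C(k, 2) * P c k.
Proof.
by move=> cc'; have := @hpoch_rev _ _ idfun q 1 c c' k q0 cc'; rewrite /= mulr1.
Qed.

Lemma hpoch_qV_neq0 M k : (k <= M)%N -> P (q ^- M) k != 0.
Proof.
move=> lekM; rewrite (@hpoch_rev1 k (q * q ^+ (M - k))); last first.
  by rewrite mulrAC -(mulrA q) -exprD subnK // mulfK ?expf_neq0.
rewrite !mulf_neq0 ?expf_neq0 ?oppr_eq0 ?invr_eq0 ?expf_neq0 //.
have := qfact_neq0 M; rewrite -{1}(subnK lekM) hpochD mulf_eq0 negb_or.
by case/andP.
Qed.

(** The last k factors of (a)_M and of (q)_M are reversed, and their powers of q combine to q^k. The
    quotients of the summand in [RHG] that pair q^(-M) with q^(1-M) / a thereby become the shortened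
    products of [Rnum]. *)
Lemma hpoch_flip M k a : (k <= M)%N -> a != 0 ->
  P (q ^- M) k * P a M * P q (M - k) * q ^+ k
  = P q M * P a (M - k) * a ^+ k * P (q ^ (1 - M%:Z) / a) k.
Proof.
move=> lekM a0.
have PM b : P b M = P b (M - k) * P (b * q ^+ (M - k)) k.
  by rewrite -{1}(subnK lekM) hpochD.
rewrite (PM a) (PM q) {PM}.
have eM : q ^+ (M - k) * q ^+ k = q ^+ M by rewrite -exprD subnK.
rewrite (@hpoch_rev1 k (q * q ^+ (M - k)) (q ^- M)); last first.
  by rewrite mulrAC -(mulrA q) eM; field; rewrite expf_neq0.
rewrite (@hpoch_rev1 k (a * q ^+ (M - k)) (q ^ (1 - M%:Z) / a)); last first.
  transitivity (q ^ (1 - M%:Z) * (q ^+ (M - k) * q ^+ k)); first by field.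
  by rewrite eM exprnP -expfzDr // subrK.
have -> : - (q ^ (1 - M%:Z) / a) = - q ^- M * (q / a).
  by rewrite expfzDr // expr1z -exprnN; ring.
rewrite (exprMn _ (- q ^- M)) (exprMn _ q) exprVn.
have := expf_neq0 k a0; move: (a ^+ k) => ak ak0.
move: (P _ _) (P _ _) (P _ _) (P _ _) => h1 h2 h3 h4.
by field.
Qed.

Variables (al be L z : F) (N I J : nat).
Hypotheses (al0 : al != 0) (be0 : be != 0) (L0 : L != 0).
Hypotheses (leIN : (I <= N)%N) (leJN : (J <= N)%N).
Hypothesis zE : z = L / q.
Hypothesis den_bi : P be^-1 (N - I) != 0.
Hypothesis den_z : P z^-1 N != 0.
Hypothesis den_al : forall k, P (q ^ (1 + I%:Z - N%:Z) * z / al) k != 0.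
Hypothesis den_be : forall k, P (q ^ (1 - J%:Z) * z / be) k != 0.

Let hpochL b k : P (b / z) k = hpoch q L (q * b) k / L ^+ k.
Proof.
have -> : L = L * 1 by rewrite mulr1.
have -> : q * b = L * (b / z) by rewrite zE; field; rewrite L0 q0.
by rewrite hpochZ mulr1 mulrAC mulfV ?mul1r // expf_neq0.
Qed.

Lemma RHG_Rnum :
  L ^+ N * P be^-1 (N - I) * hpoch q L q N * RHG q al be z N I J
  = L ^+ (N + I - J) * Rnum q al be be^-1 L N I J.
Proof.
have z0 : z != 0 by rewrite zE mulf_neq0 ?invr_eq0.
rewrite /RHG /Rnum !mulr_sumr; apply: eq_bigr => -[k ltkJ] _ /=.
rewrite !qpochE.
(* For k > N - I both terms vanish: on one side by the q-binomial, on the other because (q^(I-N))_k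
   contains the factor 1 - q^0. *)
have [lekM | ltMk] := leqP k (N - I); last first.
  rewrite (qbin_small _ ltMk) !mul0r mulr0.
  have -> : P (q ^ (I%:Z - N%:Z)) k = 0; last by rewrite !(mul0r, mulr0).
  rewrite -(subnKC ltMk) hpochD hpochS.
  rewrite (_ : 1 - _ * q ^+ (N - I) = 0) ?mulr0 ?mul0r //.
  apply/eqP; rewrite subr_eq0 exprnP -expfzDr //.
  by rewrite (_ : I%:Z - N%:Z + (N - I)%N%:Z = 0) // -subzn //; ring.
have lekJ : (k <= J)%N by rewrite -ltnS.
have lekN : (k <= N)%N by apply: leq_trans lekJ leJN.
have LL : L ^+ N * L ^+ N
    = L ^+ (N + I - J) * L ^+ (J - k) * L ^+ (N - I - k) * L ^+ k * L ^+ k.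
  by rewrite -!exprD; congr (_ ^+ _); lia.
have flipJ := hpoch_flip lekJ (mulf_neq0 be0 (invr_neq0 z0)).
have flipI := hpoch_flip lekM (mulf_neq0 al0 (invr_neq0 z0)).
have flipN := hpoch_flip lekN (invr_neq0 z0).
rewrite invf_div mulrA in flipJ; rewrite invf_div mulrA in flipI; rewrite invrK in flipN.
have eNI : q ^ (1 - (N - I)%N%:Z) = q ^ (1 + I%:Z - N%:Z).
  by congr (_ ^ _); rewrite -subzn //; ring.
have eNI' : q ^- (N - I) = q ^ (I%:Z - N%:Z).
  by rewrite exprnN; congr (_ ^ _); rewrite -subzn //; ring.
rewrite eNI eNI' in flipI.
have zN : P z^-1 N = P z^-1 (N - k) * P (q ^+ (N - k) / z) k.
  by rewrite -{1}(subnK lekN) hpochD [z^-1 * _]mulrC.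
have zNk0 : P z^-1 (N - k) != 0.
  by move: den_z; rewrite zN mulf_eq0 negb_or => /andP[].
have dE : P (z / (al * be)) k = hpoch q (q * al * be) L k / (q * al * be) ^+ k.
  have qab0 : q * al * be != 0 by rewrite !mulf_neq0.
  have -> : L = (q * al * be) * (z / (al * be)).
    by rewrite zE; field; rewrite al0 be0 q0.
  by rewrite -{1}[q * al * be]mulr1 hpochZ [RHS]mulrC mulKf ?expf_neq0.
have bJ : qbin q (N - k) (J - k) = P q (N - k) / (P q (J - k) * P q (N - J)).
  have leJk : (J - k <= N - k)%N by apply: leq_sub2r.
  rewrite -(qbin_hpoch q leJk) (_ : (N - k - (J - k) = N - J)%N); last by lia.
  by rewrite mulfK // mulf_neq0.
have bI : qbin q (N - I) k = P q (N - I) / (P q k * P q (N - I - k)).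
  by rewrite -(qbin_hpoch q lekM) mulfK // mulf_neq0.
have fN0 := hpoch_qV_neq0 lekN.
have qk0 := expf_neq0 k q0; have zk0 := expf_neq0 k z0.
have aE : P (q ^- J) k * P (be / z) J = P q J * (hpoch q L (q * be) (J - k) / L ^+ (J - k))
    * (be / z) ^+ k * P (q ^ (1 - J%:Z) * z / be) k / (P q (J - k) * q ^+ k).
  by rewrite -hpochL -flipJ; field; rewrite qfact_neq0 qk0.
have bE : P (q ^ (I%:Z - N%:Z)) k * P (al / z) (N - I)
    = P q (N - I) * (hpoch q L (q * al) (N - I - k) / L ^+ (N - I - k))
    * (al / z) ^+ k * P (q ^ (1 + I%:Z - N%:Z) * z / al) k / (P q (N - I - k) * q ^+ k).
  by rewrite -hpochL -flipI; field; rewrite qfact_neq0 qk0.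
have cE : P (q ^ (1 - N%:Z) * z) k = P (q ^- N) k
    * (hpoch q L (q ^+ (N - k).+1) k / L ^+ k) * P q (N - k) * q ^+ k * z ^+ k / P q N.
  rewrite exprS -hpochL; apply: (mulfI (mulf_neq0 (mulf_neq0 (qfact_neq0 N) zNk0)
    (expf_neq0 k (invr_neq0 z0)))).
  rewrite -flipN zN exprVn.
  move: (P _ _) (P _ _) (P _ _) (P _ _) (qfact_neq0 N) => h1 h2 h3 h4.
  by move: (P q N) => h5 h50; field; rewrite h50 zk0.
have hLN : hpoch q L q N = L ^+ N * P z^-1 N.
  by rewrite -[z^-1]mul1r hpochL mulr1 mulrC mulfVK // expf_neq0.
have zk : z ^+ k = L ^+ k / q ^+ k by rewrite zE exprMn exprVn.
rewrite hLN bJ bI dE cE exprVn.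
transitivity ((L ^+ N * L ^+ N) * P z^-1 N * P be^-1 (N - I) * (be ^+ J)^-1
  * (P q N * P be^-1 (N - J) / (P q J * P q (N - J) * P z^-1 N * P be^-1 (N - I)))
  * (P (q ^- J) k * P (be / z) J) * (P (q ^ (I%:Z - N%:Z)) k * P (al / z) (N - I))
  * (P (q ^- N) k * (hpoch q L (q ^+ (N - k).+1) k / L ^+ k) * P q (N - k) * q ^+ k
     * z ^+ k / P q N) * (hpoch q (q * al * be) L k / (q * al * be) ^+ k)
  / (P q k * P (q ^- N) k * P (q ^ (1 + I%:Z - N%:Z) * z / al) k
     * P (q ^ (1 - J%:Z) * z / be) k) * q ^+ k); first by ring.
rewrite LL aE bE !exprMn exprVn zk.
have beJ0 := expf_neq0 J be0; have bek0 := expf_neq0 k be0.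
have alk0 := expf_neq0 k al0; have Lk0 := expf_neq0 k L0.
have LJ0 := expf_neq0 (J - k) L0; have LI0 := expf_neq0 (N - I - k) L0.
move: (L ^+ (N + I - J)) (L ^+ (J - k)) (L ^+ (N - I - k)) (L ^+ k) LJ0 LI0 Lk0.
move: (be ^+ J) (be ^+ k) (al ^+ k) (q ^+ k) beJ0 bek0 alk0 qk0.
move: (P z^-1 N) den_z (P be^-1 (N - I)) den_bi (P be^-1 (N - J)).
move: (P (q ^- N) k) fN0 (P (q ^ (1 + I%:Z - N%:Z) * z / al) k) (den_al k).
move: (P (q ^ (1 - J%:Z) * z / be) k) (den_be k).
move: (hpoch q L _ k) (hpoch q L _ _) (hpoch q L _ _) (hpoch q _ L _).
move: (P q N) (qfact_neq0 N) (P q J) (qfact_neq0 J) (P q (N - J)) (qfact_neq0 (N - J)).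
move: (P q (N - k)) (P q (J - k)) (qfact_neq0 (J - k)) (P q (N - I)).
move: (P q (N - I - k)) (qfact_neq0 (N - I - k)) (P q k) (qfact_neq0 k).
move=> *; field.
by do ?[apply/andP; split].
Qed.

End HypergeometricBlock.

(** * The infinite product as a coefficientwise limit *)

Section QBinomialLimit.
Variables (K : numFieldType) (q : K).
Hypothesis q_lt1 : `|q| < 1.
Hypothesis cvg_qpow : ((fun M => q ^+ M : K^o) @ \oo --> (0 : K^o))%classic.

Lemma qpow_neq1 k : 1 - q ^+ k.+1 != 0.
Proof.
rewrite subr_eq0; apply: contraTneq q_lt1 => q1.
have : `|q| ^+ k.+1 = 1 by rewrite -normrX -q1 normr1.
by move/eqP; rewrite pexpr_eq1 // => /eqP ->; rewrite ltxx.
Qed.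

Lemma qfact_neq0 k : hpoch q 1 q k != 0.
Proof.
elim: k => [|k IHk]; first by rewrite hpoch0 oner_eq0.
by rewrite hpochS mulf_neq0 // -exprS qpow_neq1.
Qed.

(** The recursion [qbin_next] passes to the limit because q^(M-k) tends to 0. With [coef_prod_qexp]
    this yields Euler's series for (c z; q)_oo. *)
Lemma cvg_qbin k :
  ((fun M => qbin q M k : K^o) @ \oo --> ((hpoch q 1 q k)^-1 : K^o))%classic.
Proof.
elim: k => [|k IHk].
  rewrite hpoch0 invr1 (_ : (fun=> _) = fun=> 1); last by apply/funext => M; rewrite qbin0.
  exact: cvg_cst.
have -> : (fun M => qbin q M k.+1 : K^o)
    = fun M => (1 - q ^+ k.+1)^-1 * ((1 - q ^+ (M - k)) * qbin q M k).
  by apply/funext => M; rewrite -qbin_next mulKf ?qpow_neq1.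
have -> : (hpoch q 1 q k.+1)^-1 = (1 - q ^+ k.+1)^-1 * ((1 - 0) * (hpoch q 1 q k)^-1).
  by rewrite subr0 mul1r hpochS -exprS invfM mulrC.
apply: cvgM; first exact: cvg_cst.
apply: cvgM => //.
apply: cvgB; first exact: cvg_cst.
rewrite -(cvg_shiftn k).
under eq_fun do rewrite addnK.
exact: cvg_qpow.
Qed.

Lemma lim_qbin k x : limn (fun M => qbin q M k * x : K^o) = x / hpoch q 1 q k.
Proof.
apply: cvg_lim; first exact: norm_hausdorff.
by rewrite mulrC; apply: cvgM; [exact: cvg_qbin | exact: cvg_cst].
Qed.

End QBinomialLimit.

Section QExponentialLimit.
Variable R : realType.
Implicit Types (q c : R[i]) (M k : nat).

Lemma coef_prod_qexp q c M k :
  (\prod_(s < M) (1 - (c * q ^+ s) *: 'X) : {poly R[i]})`_k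
  = qbin q M k * ((- c) ^+ k * q ^+ 'C(k, 2)).
Proof.
elim: M k => [|M IHM] k.
  by rewrite big_ord0 coef1; case: k => [|k]; rewrite ?mul0r // mul1r mulr1.
rewrite big_ord_recr /= mulrBr mulr1 -scalerAr coefB coefZ coefMX !IHM.
case: k => [|k] /=; first by rewrite mulr0 subr0 !qbin0.
rewrite qbinS; have [leMk | ltkM] := ltnP M k.
  by rewrite !qbin_small ?ltnS // 1?ltnW //; ring.
have -> : q ^+ M = q ^+ (M - k) * q ^+ k by rewrite -exprD subnK.
by rewrite binS bin1 exprD exprS; ring.
Qed.

(** Norms in [R[i]] are complex numbers on the real axis, so both |q| and the bound e descend to R,
    where convergence of geometric sequences applies. *)
Lemma cvg_qpow q : `|q| < 1 -> ((fun M => q ^+ M : R[i]^o) @ \oo --> (0 : R[i]^o))%classic.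
Proof.
move=> q_lt1; apply/cvgr0Pnorm_lt => e e0.
have [r nq] : exists r : R, `|q| = (r%:C)%C by rewrite /Num.norm /=; eexists.
have r1 : `|r| < 1.
  rewrite ger0_norm; last by rewrite -lecR -nq normr_ge0.
  by rewrite -ltcR -nq.
have [f ef] : exists f : R, e = (f%:C)%C.
  by exists (complex.Re e); apply/esym/RRe_real/gtr0_real.
have f0 : 0 < f by rewrite -ltcR -ef.
have /cvgr0Pnorm_lt /(_ f f0) := cvg_expr r1.
apply: filterS => M rM; change (`|q ^+ M : R[i]| < e).
rewrite normrX nq ef -rmorphXn /= ltcR.
by apply: le_lt_trans rM; exact: ler_norm.
Qed.

Lemma phiE q c : `|q| < 1 -> PS (phi q c) = qexp q c.
Proof.
move=> q_lt1; apply: ps_ext => k; rewrite /phi /=.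
under eq_fun do rewrite coef_prod_qexp.
exact: lim_qbin (cvg_qpow q_lt1) _ _.
Qed.

End QExponentialLimit.

(** * Laurent series, diagonals and expansions of rational functions *)

Section LaurentSeries.
Variable C : fieldType.
Implicit Types (f : nat -> C) (u : lseries C) (F : ps (ps C)).

Definition series_of u : ps (ps C) := PS (fun a => PS (lcoef u a)).

Lemma series_of_mul_x f u : series_of (mul_x f u) = inx (PS f) * series_of u.
Proof. by apply: psc2_ext => a b; rewrite psc2_inxM. Qed.

Lemma series_of_mul_Lx f u : series_of (mul_Lx f u) = iny (PS f) * series_of u.
Proof. by apply: psc2_ext => a b; rewrite psc2_inyM. Qed.

Lemma series_of_mul_L f u : series_of (mul_L f u) = inL (PS f) * series_of u.
Proof. by apply: psc2_ext => a b; rewrite psc2_inLM. Qed.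

Lemma series_of_qBorel q u :
  series_of (qBorel q u) = borel q (lbase u) (series_of u).
Proof. by []. Qed.

Lemma series_of_xpow i : series_of (xpow C i) = 1.
Proof.
by apply: psc2_ext => a b; rewrite /psc2 psc1; case: a => [|a] //=; case: b.
Qed.

Lemma ps_inv_nth f k l : (l <= k)%N -> (ps_inv_seq f k)`_l = ps_inv f l.
Proof.
have size_inv n : size (ps_inv_seq f n) = n.+1.
  by elim: n => //= n IHn; rewrite size_rcons IHn.
elim: k => [|k IHk]; first by rewrite leqn0 => /eqP ->.
rewrite leq_eqVlt => /predU1P[-> // | ltlk].
by rewrite /= nth_rcons size_inv ltlk IHk.
Qed.

Lemma ps_invK f : f 0%N != 0 -> PS f * PS (ps_inv f) = 1.
Proof.
move=> f0; apply: ps_ext => k; rewrite pscM psc1 big_ord_recl /= subn0.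
case: k => [|k]; first by rewrite big_ord0 addr0 /ps_inv /= mulfV.
have -> : ps_inv f k.+1 = - (f 0%N)^-1 * \sum_(l < k.+1) f l.+1 * ps_inv f (k - l)%N.
  rewrite {1}/ps_inv /= nth_rcons.
  have -> : size (ps_inv_seq f k) = k.+1.
    by elim: k => //= k IHk; rewrite size_rcons IHk.
  rewrite ltnn eqxx; congr (_ * _); apply: eq_bigr => l _.
  by rewrite ps_inv_nth // leq_subr.
rewrite mulrA mulrN mulfV // mulN1r addrC; apply/eqP; rewrite subr_eq0.
by apply/eqP/eq_bigr => l _; rewrite subSS.
Qed.

(* The coefficient of Lambda^b x^t in a series in x and y = Lambda / x. *)
Definition diag (t : int) F (b : nat) : C :=
  if (t + b%:Z)%R is Posz a then psc2 F a b else 0.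

Lemma diag_sum t n (F : 'I_n -> ps (ps C)) b :
  diag t (\sum_(s < n) F s) b = \sum_(s < n) diag t (F s) b.
Proof.
rewrite /diag; case: (t + b%:Z)%R => a; last by rewrite big1.
by apply: (big_morph (fun G => psc2 G a b)) => // *; rewrite psc2D.
Qed.

Lemma diag_inLM t f F b :
  diag t (inL (PS f) * F) b = \sum_(c < b.+1) f c * diag t F (b - c).
Proof.
rewrite /diag; case ta : (t + b%:Z)%R => [a | a]; last first.
  rewrite big1 // => -[c ltcb] _ /=.
  have : (t + (b - c)%N%:Z < 0)%R by lia.
  by case: (t + _)%R => // a'; rewrite mulr0.
rewrite psc2_inLM (@big_ord_widen _ _ _ _ b.+1
  (fun s => psc (PS f) s * psc2 F (a - s) (b - s))) ?ltnS ?geq_minr //.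
rewrite big_mkcond; apply: eq_bigr => -[c ltcb] _ /=.
rewrite ltnS leq_min (_ : (c <= b)%N) // andbT.
case: leqP => [leca | ltac].
  by rewrite (_ : (t + (b - c)%N%:Z)%R = (a - c)%N%:Z) //; lia.
have : (t + (b - c)%N%:Z < 0)%R by lia.
by case: (t + _)%R => // a'; rewrite mulr0.
Qed.

Lemma diag_mono t s s' b :
  diag t (varx C ^+ s * vary C ^+ s') b = ((b == s') && (t + s'%:Z == s%:Z))%:R.
Proof.
rewrite /diag -[_ * _]mulr1.
case ta : (t + b%:Z)%R => [a | a].
  rewrite psc2_monoM; case: ifP => [/andP[les les'] | nles].
    rewrite (_ : psc2 1 _ _ = ((a - s == 0)%N && (b - s' == 0)%N)%:R).
      by congr (nat_of_bool _)%:R; lia.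
    by rewrite /psc2 psc1; case: (a - s)%N => [|?] //=; case: (b - s')%N.
  by rewrite (_ : _ && _ = false) //; lia.
by rewrite (_ : _ && _ = false) //; lia.
Qed.

(** Since x^s y^s' = x^(s-s') Lambda^s', only the diagonal t = s - s' is met, with a shift by s' in
    Lambda. *)
Lemma diag_polyM t (p : {poly C}) s s' b :
  diag t (inL (ps_poly p) * (varx C ^+ s * vary C ^+ s')) b
  = if t + s'%:Z == s%:Z then ('X^s' * p)`_b else 0.
Proof.
rewrite diag_inLM coefXnM.
under eq_bigr do rewrite diag_mono.
case: ifP => [_ | _]; last by rewrite big1 // => c _; rewrite andbF mulr0.
case: ltnP => [ltbs | lesb].
  rewrite big1 // => c _; rewrite andbT (_ : (b - c == s')%N = false) ?mulr0 //.
  by lia.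
have ltc : (b - s' < b.+1)%N by lia.
rewrite (bigD1 (Ordinal ltc)) //= andbT subKn // eqxx mulr1 big1 ?addr0 // => -[c ltcb].
rewrite -val_eqE /= andbT => neqc.
by rewrite (_ : (b - c == s')%N = false) ?mulr0 //; lia.
Qed.

(** If p = d s and p' = d' s as power series, then p d' = p' d there, hence already as
    polynomials. *)
Lemma expansion_uniq (f g : {fraction {poly C}}) (s : nat -> C) :
  expansion_of f s -> expansion_of g s -> f = g.
Proof.
case=> [p [d [d0 -> pE]]] [p' [d' [d'0 -> p'E]]].
have eqs (a b : {poly C}) : (forall n : nat, a`_n = \sum_(c < n.+1) b`_c * s (n - c)%N) ->
    ps_poly a = ps_poly b * PS s.
  by move=> ab; apply: ps_ext => n; rewrite /= ab.
have pd' : p * d' = p' * d.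
  have psM (a b : {poly C}) : ps_poly (a * b) = ps_poly a * ps_poly b by rewrite rmorphM.
  by apply: ps_poly_inj; rewrite !psM (eqs _ _ pE) (eqs _ _ p'E); ring.
apply/eqP; rewrite eqr_div ?tofrac_eq0 //.
by rewrite -!tofracM pd'.
Qed.

End LaurentSeries.

HB.instance Definition _ (C : fieldType) :=
  GRing.RMorphism.copy (@constL C) (@tofrac {poly C} \o polyC).

Lemma one_subCLam_neq0 (C : fieldType) (a : C) : 1 - constL a * Lam C != 0.
Proof.
rewrite -tofracM -tofrac1 -tofracB tofrac_eq0; apply/eqP => /(congr1 (coefp 0)) /eqP.
by rewrite /= coefB coef1 coefCM coefX mulr0 subr0 coef0 oner_eq0.
Qed.

Lemma Lam_neq0 (C : fieldType) : Lam C != 0.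
Proof. by rewrite tofrac_eq0 polyX_eq0. Qed.

Lemma one_subCLamV_neq0 (C : fieldType) (a : C) : 1 - constL a * (Lam C)^-1 != 0.
Proof.
rewrite -(mulfV (Lam_neq0 C)) -mulrBl mulf_neq0 ?invr_eq0 ?Lam_neq0 //.
by rewrite -tofracB tofrac_eq0 polyXsubC_eq0.
Qed.

(** * The block as a matrix of rational functions of Lambda *)

Section BlockExpansion.
Variables (C : fieldType) (q d1 d4 : C) (m n : nat).
Hypotheses (q0 : q != 0) (qfact_neq0 : forall k, hpoch q 1 q k != 0).
Hypotheses (d10 : d1 != 0) (d40 : d4 != 0).
Hypothesis d4_generic : forall s : nat, (s < m + n)%N -> d4 * q ^ (s%:Z - m%:Z) != 1.
Let N := (m + n)%N.
Variables al be bi : C.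
Hypotheses (alE : al = q ^+ n / d1) (beE : be = q ^+ m / d4) (biE : bi = d4 / q ^+ m).

(** Since bi q^s = d4 q^(s-m), this is where [d4_generic] enters. The denominators of the block that
    contain z are nonzero because Lambda is transcendental over the constants. *)
Let bi_neq0 I : hpoch q 1 bi (N - I) != 0.
Proof.
apply/prodf_neq0 => -[s ltsN] _ /=; rewrite subr_eq0 eq_sym biE.
have ltsmn : (s < m + n)%N by apply: leq_trans ltsN (leq_subr _ _).
by have := d4_generic ltsmn; rewrite expfzDr // -exprnN mulrA mulrAC.
Qed.

Let constL_neq0 (a : C) : a != 0 -> constL a != 0.
Proof. by rewrite fmorph_eq0. Qed.

Let beVE : (constL be)^-1 = constL bi.
Proof. by rewrite -fmorphV beE biE invf_div. Qed.

Let z := Lam C / constL q.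

Let hpoch_z_neq0 a k : hpoch (constL q) 1 (constL a * z) k != 0.
Proof.
apply/prodf_neq0 => s _ /=.
have -> : constL a * z * constL q ^+ s = constL (a / q * q ^+ s) * Lam C.
  by rewrite !rmorphM rmorphXn fmorphV /z; ring.
exact: one_subCLam_neq0.
Qed.

Let hpoch_zV_neq0 k : hpoch (constL q) 1 z^-1 k != 0.
Proof.
apply/prodf_neq0 => s _ /=.
have -> : z^-1 * constL q ^+ s = constL (q * q ^+ s) * (Lam C)^-1.
  by rewrite rmorphM rmorphXn /z invf_div; ring.
exact: one_subCLamV_neq0.
Qed.

Let tofracC (a : C) : tofrac a%:P = constL a. Proof. by []. Qed.

Lemma tofrac_den_poly I : tofrac (den_poly q m n bi I)
  = Lam C ^+ N * constL (hpoch q 1 bi (N - I)) * hpoch (constL q) (Lam C) (constL q) N.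
Proof.
rewrite /den_poly !tofracM tofracXn tofracC; congr (_ * _).
exact: (rmorph_hpoch (@tofrac {poly C})).
Qed.

Lemma den_poly_neq0 I : den_poly q m n bi I != 0.
Proof.
rewrite -tofrac_eq0 tofrac_den_poly !mulf_neq0 ?expf_neq0 ?Lam_neq0 ?constL_neq0 //.
apply/prodf_neq0 => s _ /=.
have -> : constL q * constL q ^+ s = tofrac (q * q ^+ s)%:P.
  by rewrite tofracC rmorphM rmorphXn.
by rewrite -tofracB tofrac_eq0 polyXsubC_eq0.
Qed.

Lemma RHG_num_den I J : (I <= N)%N -> (J <= N)%N ->
  constL (d1 ^+ (N - I) * q ^ ((m%:Z + 1) * (I%:Z - n%:Z)))
  * RHG (constL q) (constL al) (constL be) z N I J
  = tofrac ('X^(N + I - J) * num_poly q m n d1 al be bi I J)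
    / tofrac (den_poly q m n bi I).
Proof.
move=> leIN leJN; have den0 := den_poly_neq0 I.
have qL0 := constL_neq0 q0.
have alL0 : constL al != 0.
  by apply: constL_neq0; rewrite alE mulf_neq0 ?invr_eq0 ?expf_neq0.
have beL0 : constL be != 0.
  by apply: constL_neq0; rewrite beE mulf_neq0 ?invr_eq0 ?expf_neq0.
have qfL k : hpoch (constL q) 1 (constL q) k != 0.
  by rewrite -(rmorph1 (@constL C)) -rmorph_hpoch constL_neq0.
have main := @RHG_Rnum _ _ qL0 qfL (constL al) (constL be) (Lam C) z N I J
  alL0 beL0 (Lam_neq0 C) leIN leJN erefl.
apply: (mulIf (_ : tofrac (den_poly q m n bi I) != 0)); first by rewrite tofrac_eq0.
rewrite divfK ?tofrac_eq0 // tofrac_den_poly.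
have RnumE : tofrac (Rnum q%:P al%:P be%:P bi%:P 'X N I J)
    = Rnum (constL q) (constL al) (constL be) (constL be)^-1 (Lam C) N I J.
  rewrite beVE; exact: (rmorph_Rnum (@tofrac {poly C})).
have biE' : constL (hpoch q 1 bi (N - I)) = hpoch (constL q) 1 (constL be)^-1 (N - I).
  by rewrite beVE -(rmorph1 (@constL C)); exact: (rmorph_hpoch (@constL C)).
rewrite /num_poly !tofracM tofracXn tofracC RnumE [RHS]mulrCA -main.
- by rewrite biE'; ring.
- by rewrite -biE' constL_neq0.
- exact: hpoch_zV_neq0.
- move=> k; rewrite -fmorphXz mulrAC -fmorphV -rmorphM.
  exact: hpoch_z_neq0.
- move=> k; rewrite -fmorphXz mulrAC -fmorphV -rmorphM.
  exact: hpoch_z_neq0.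
Qed.

Lemma diag_HSser I (t : int) b : (I <= N)%N ->
  \sum_(c < b.+1) (den_poly q m n bi I)`_c
    * diag t (HSser q d1 (q ^- m) (q ^- n) d4 (I%:Z - n%:Z)) (b - c)
  = \sum_(J < N.+1)
      if t + I%:Z == J%:Z
      then ('X^(N + I - J) * num_poly q m n d1 al be bi I J)`_b else 0.
Proof.
move=> leIN.
have := den_poly_HSser q0 qfact_neq0 d10 d40 alE beE biE leIN.
move/(congr1 (fun F => diag t F b)); rewrite diag_sum diag_inLM => ->.
apply: eq_bigr => -[J ltJN] _ /=; rewrite diag_polyM.
by congr (if _ then _ else _); rewrite -/N; lia.
Qed.

End BlockExpansion.

Section MatrixElements.
Variables (R : realType) (q d1 d4 : R[i]) (m n : nat).
Hypotheses (q0 : q != 0) (q_lt1 : `|q| < 1) (d10 : d1 != 0) (d40 : d4 != 0).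
Hypothesis d4_generic : forall s : nat, (s < m + n)%N -> d4 * q ^ (s%:Z - m%:Z) != 1.
Let N := (m + n)%N.

Let qf0 k : hpoch q 1 q k != 0. Proof. exact: qfact_neq0. Qed.

Lemma phiVE c : PS (phiV q c) = qexpV q c.
Proof.
have phi0 : phi q c 0%N != 0.
  have := congr1 (fun f => psc f 0) (phiE c q_lt1); rewrite /= => ->.
  by rewrite hpoch0 invr1 !mulr1 oner_eq0.
have := ps_invK phi0; rewrite phiE // => inv.
by rewrite -[LHS]mul1r -(qexpK qf0 c) mulrAC inv mul1r.
Qed.

Lemma series_of_HS d2 d3 i :
  series_of (HS q d1 d2 d3 d4 (xpow _ i)) = HSser q d1 d2 d3 d4 i.
Proof.
rewrite /HS series_of_mul_x series_of_mul_Lx series_of_qBorel.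
rewrite !series_of_mul_L !series_of_mul_x !series_of_mul_Lx.
rewrite series_of_qBorel series_of_mul_x series_of_mul_Lx series_of_xpow.
by rewrite !(phiE _ q_lt1) !phiVE.
Qed.

Lemma expansion_HS i j : - n%:Z <= i <= m%:Z ->
  expansion_of
    (if - n%:Z <= j <= m%:Z then
       constL d1 ^ (m%:Z - i) * constL q ^ ((m%:Z + 1) * i)
       * RHG (constL q) (constL (q ^+ n / d1)) (constL (q ^+ m / d4)) (Lam _ / constL q)
             (m + n) (absz (i + n%:Z)) (absz (j + n%:Z))
     else 0)
    (coefLx (HS q d1 (q ^- m) (q ^- n) d4 (xpow _ i)) j).
Proof.
move=> range_i; set I := absz (i + n%:Z); set J := absz (j + n%:Z).
have iE : i = I%:Z - n%:Z by rewrite /I; lia.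
have leIN : (I <= N)%N by rewrite /I /N; lia.
(* Neither the multiplications nor B change [lbase], so it remains i and the coefficient of x^j lies
   on the diagonal j - i. *)
have diag_coefLx b : coefLx (HS q d1 (q ^- m) (q ^- n) d4 (xpow _ i)) j b
    = diag (j - i) (HSser q d1 (q ^- m) (q ^- n) d4 (I%:Z - n%:Z)) b.
  by rewrite -iE -series_of_HS.
pose num := num_poly q m n d1 (q ^+ n / d1) (q ^+ m / d4) (d4 / q ^+ m) I.
exists (if - n%:Z <= j <= m%:Z then 'X^(N + I - J) * num J else 0).
exists (den_poly q m n (d4 / q ^+ m) I); split.
- exact: (den_poly_neq0 q0 d4_generic erefl).
- case: ifP => [range_j | _]; last by rewrite tofrac0 mul0r.
  have leJN : (J <= N)%N by rewrite /J /N; lia.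
  rewrite -(RHG_num_den q0 qf0 d10 d40 d4_generic erefl erefl erefl leIN leJN).
  congr (_ * _); rewrite rmorphM rmorphXn (fmorphXz (@constL _)) -iE.
  by congr (_ * _); rewrite exprnP; congr (_ ^ _); rewrite /N /I; lia.
move=> b; under eq_bigr do rewrite diag_coefLx.
rewrite (diag_HSser q0 qf0 d10 d40 erefl erefl erefl) //.
case: ifP => [range_j | range_j].
  have ltJN : (J < N.+1)%N by rewrite /J /N; lia.
  rewrite (bigD1 (Ordinal ltJN)) //= ifT; last by rewrite /I /J; lia.
  rewrite big1 ?addr0 // => -[J' ltJ'] /=; rewrite -val_eqE /= => neqJ.
  by rewrite ifF //; move: neqJ; rewrite /I /J; lia.
(* Invariance of the span: for j outside the range, no J <= N lies on the diagonal j - i, so every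
   coefficient of x^j, multiplied by the denominator, vanishes. *)
rewrite coef0 big1 // => -[J' ltJ'] _ /=.
by rewrite ifF //; move: ltJ' range_j; rewrite /I /N; lia.
Qed.

End MatrixElements.

Theorem theorem1p1 (R : realType) (q d1 d4 : R[i]) (m n : nat)
    (q_neq0 : q != 0) (q_lt1 : `|q| < 1)
    (d1_neq0 : d1 != 0) (d4_neq0 : d4 != 0)
    (d4_generic : forall s : nat, (s < m + n)%N ->
       d4 * q ^ (s%:Z - m%:Z) != 1) :
  (exists r : int -> int -> {fraction {poly R[i]}}, is_matrix_of_HS q d1 d4 m n r) /\
  (forall r : int -> int -> {fraction {poly R[i]}}, is_matrix_of_HS q d1 d4 m n r ->
   forall i j : int, - n%:Z <= i <= m%:Z -> - n%:Z <= j <= m%:Z ->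
     r i j =
       constL d1 ^ (m%:Z - i) * constL q ^ ((m%:Z + 1) * i)
       * RHG (constL q) (constL (q ^+ n / d1)) (constL (q ^+ m / d4)) (Lam _ / constL q)
             (m + n) (absz (i + n%:Z)) (absz (j + n%:Z))).
Proof.
have expansion := expansion_HS q_neq0 q_lt1 d1_neq0 d4_neq0 d4_generic.
split; first by eexists => i range_i j; exact: (expansion i j range_i).
move=> r mat_r i j range_i range_j.
have := expansion_uniq (mat_r i range_i j) (expansion i j range_i).
by rewrite range_j.
Qed.
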